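(* $\mathsf{RCA}_0$ does not prove $\mathrm{WKL}(ext\text{-}bd)$, the statement: for every infinite tree $T\subseteq 2^{<\mathbb{N}}$, if there exists $c\in\mathbb{N}$ such that $|T_{\mathrm{ext}}^{=n}|\le c$ for all $n\in\mathbb{N}$, then $T$ has a path.
   Context: $\mathsf{RCA}_0$ is the usual base system of second-order arithmetic. A tree $T\subseteq 2^{<\mathbb{N}}$ is a set of finite binary strings closed under initial segments; $\mathrm{lh}(\sigma)$ is the length of $\sigma$. A path of $T$ is a function (existing as a second-order object) all of whose finite initial segments are in $T$. A node $\sigma\in T$ is extendible if it has extensions in $T$ of arbitrarily large length. $T_{\mathrm{ext}}^{=n}=\{\sigma\in T\mid \mathrm{lh}(\sigma)=n\text{ and }\sigma\text{ is extendible}\}$. $|A|\le c$ means that every finite set $F\subseteq A$ (coded by a natural number) satisfies $|F|\le c$. *)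

(* Defs.v *)
From Stdlib Require Import List Arith.
Import ListNotations.

(** * Syntax of second-order arithmetic

    Two-sorted first-order logic with de Bruijn indices.  Number variables and
    set variables are indexed separately: a number quantifier binds number
    index [0] and leaves set indices alone, and vice versa. *)

Inductive term : Type :=
| Var (n : nat)
| Zero
| One
| Plus (s t : term)
| Times (s t : term).

Inductive form : Type :=
| Falsum
| Equal (s t : term)
| Less (s t : term)
| Mem (t : term) (X : nat)
| Imp (p q : form)
| And (p q : form)
| Or (p q : form)
| AllNum (p : form)
| ExNum (p : form)
| AllSet (p : form)
| ExSet (p : form).

Definition Neg (p : form) : form := Imp p Falsum.
Definition Iff (p q : form) : form := And (Imp p q) (Imp q p).

Fixpoint tsubst (sg : nat -> term) (t : term) : term :=
  match t with
  | Var n   => sg n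
  | Zero    => Zero
  | One     => One
  | Plus s t => Plus (tsubst sg s) (tsubst sg t)
  | Times s t => Times (tsubst sg s) (tsubst sg t)
  end.

Definition tshift : term -> term := tsubst (fun n => Var (S n)).

Definition tcons (t : term) (sg : nat -> term) (n : nat) : term :=
  match n with 0 => t | S n => sg n end.

Definition scons (X : nat) (rh : nat -> nat) (n : nat) : nat :=
  match n with 0 => X | S n => rh n end.

Definition upN (sg : nat -> term) : nat -> term :=
  tcons (Var 0) (fun n => tshift (sg n)).

Definition upS (rh : nat -> nat) : nat -> nat :=
  scons 0 (fun n => S (rh n)).

(** Simultaneous capture-avoiding substitution; the only set terms are the set
    variables, so on the set sort it is a renaming. *)
Fixpoint subst (sg : nat -> term) (rh : nat -> nat) (p : form) : form :=
  match p with
  | Falsum     => Falsum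
  | Equal s t  => Equal (tsubst sg s) (tsubst sg t)
  | Less s t  => Less (tsubst sg s) (tsubst sg t)
  | Mem t X => Mem (tsubst sg t) (rh X)
  | Imp p q => Imp (subst sg rh p) (subst sg rh q)
  | And p q => And (subst sg rh p) (subst sg rh q)
  | Or p q  => Or (subst sg rh p) (subst sg rh q)
  | AllNum p  => AllNum (subst (upN sg) rh p)
  | ExNum p   => ExNum (subst (upN sg) rh p)
  | AllSet p  => AllSet (subst sg (upS rh) p)
  | ExSet p   => ExSet (subst sg (upS rh) p)
  end.

Definition idN : nat -> term := Var.
Definition idS : nat -> nat := fun n => n.

Definition shiftN : form -> form := subst (fun n => Var (S n)) idS.
Definition shiftS : form -> form := subst idN S.
Definition instN (t : term) : form -> form := subst (tcons t idN) idS.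
Definition instS (X : nat) : form -> form := subst idN (scons X idS).

(** * Classical natural deduction

    The eigenvariable conditions are imposed by shifting the context [G] only,
    so an axiom with free variables stands for its universal closure. *)

Inductive deriv (Ax : form -> Prop) : list form -> form -> Prop :=
| D_ax G p : Ax p -> deriv Ax G p
| D_hyp G p : In p G -> deriv Ax G p
| D_raa G p : deriv Ax (Neg p :: G) Falsum -> deriv Ax G p
| D_impI G p q : deriv Ax (p :: G) q -> deriv Ax G (Imp p q)
| D_impE G p q : deriv Ax G (Imp p q) -> deriv Ax G p -> deriv Ax G q
| D_andI G p q : deriv Ax G p -> deriv Ax G q -> deriv Ax G (And p q)
| D_andE1 G p q : deriv Ax G (And p q) -> deriv Ax G p
| D_andE2 G p q : deriv Ax G (And p q) -> deriv Ax G q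
| D_orI1 G p q : deriv Ax G p -> deriv Ax G (Or p q)
| D_orI2 G p q : deriv Ax G q -> deriv Ax G (Or p q)
| D_orE G p q r : deriv Ax G (Or p q) ->
    deriv Ax (p :: G) r -> deriv Ax (q :: G) r -> deriv Ax G r
| D_allNI G p : deriv Ax (map shiftN G) p -> deriv Ax G (AllNum p)
| D_allNE G p t : deriv Ax G (AllNum p) -> deriv Ax G (instN t p)
| D_exNI G p t : deriv Ax G (instN t p) -> deriv Ax G (ExNum p)
| D_exNE G p q : deriv Ax G (ExNum p) ->
    deriv Ax (p :: map shiftN G) (shiftN q) -> deriv Ax G q
| D_allSI G p : deriv Ax (map shiftS G) p -> deriv Ax G (AllSet p)
| D_allSE G p X : deriv Ax G (AllSet p) -> deriv Ax G (instS X p)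
| D_exSI G p X : deriv Ax G (instS X p) -> deriv Ax G (ExSet p)
| D_exSE G p q : deriv Ax G (ExSet p) ->
    deriv Ax (p :: map shiftS G) (shiftS q) -> deriv Ax G q
| D_refl G t : deriv Ax G (Equal t t)
| D_leibniz G p s t : deriv Ax G (Equal s t) ->
    deriv Ax G (instN s p) -> deriv Ax G (instN t p).

Definition provable (Ax : form -> Prop) (p : form) : Prop := deriv Ax [] p.

(** * Named variables

    To keep concrete sentences readable they are written with Rocq binders.  An
    expression is a function of the number of number (and set) quantifiers it
    occurs under; the variable bound by the quantifier at depth [d] is the
    de Bruijn index [d' - S d] when it is used at depth [d']. *)

Definition nexp : Type := nat -> term.
Definition sexp : Type := nat -> nat.
Definition fexp : Type := nat -> nat -> form.

Definition close (P : fexp) : form := P 0 0.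

Definition e_zero : nexp := fun _ => Zero.
Definition e_one : nexp := fun _ => One.
Definition e_add (a b : nexp) : nexp := fun d => Plus (a d) (b d).
Definition e_mul (a b : nexp) : nexp := fun d => Times (a d) (b d).
Definition e_eq (a b : nexp) : fexp := fun d _ => Equal (a d) (b d).
Definition e_lt (a b : nexp) : fexp := fun d _ => Less (a d) (b d).
Definition e_mem (a : nexp) (X : sexp) : fexp := fun d e => Mem (a d) (X e).
Definition e_neg (P : fexp) : fexp := fun d e => Neg (P d e).
Definition e_imp (P Q : fexp) : fexp := fun d e => Imp (P d e) (Q d e).
Definition e_iff (P Q : fexp) : fexp := fun d e => Iff (P d e) (Q d e).
Definition e_and (P Q : fexp) : fexp := fun d e => And (P d e) (Q d e).
Definition e_or (P Q : fexp) : fexp := fun d e => Or (P d e) (Q d e).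
Definition e_allN (P : nexp -> fexp) : fexp :=
  fun d e => AllNum (P (fun d' => Var (d' - S d)) (S d) e).
Definition e_exN (P : nexp -> fexp) : fexp :=
  fun d e => ExNum (P (fun d' => Var (d' - S d)) (S d) e).
Definition e_allS (P : sexp -> fexp) : fexp :=
  fun d e => AllSet (P (fun e' => e' - S e) d (S e)).
Definition e_exS (P : sexp -> fexp) : fexp :=
  fun d e => ExSet (P (fun e' => e' - S e) d (S e)).

Declare Scope l2_scope.
Delimit Scope l2_scope with L2.
Notation "0" := e_zero : l2_scope.
Notation "1" := e_one : l2_scope.
Notation "a + b" := (e_add a b) : l2_scope.
Notation "a * b" := (e_mul a b) : l2_scope.
Notation "a = b" := (e_eq a b) : l2_scope.
Notation "a < b" := (e_lt a b) : l2_scope.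
Notation "a <= b" := (e_or (e_lt a b) (e_eq a b)) : l2_scope.
Notation "a '∈' X" := (e_mem a X) (at level 70) : l2_scope.
Notation "~ P" := (e_neg P) : l2_scope.
Notation "P -> Q" := (e_imp P Q) : l2_scope.
Notation "P <-> Q" := (e_iff P Q) : l2_scope.
Notation "P /\ Q" := (e_and P Q) : l2_scope.
Notation "P \/ Q" := (e_or P Q) : l2_scope.
Notation "'∀' x .. y , P" := (e_allN (fun x => .. (e_allN (fun y => P)) ..))
  (at level 200, x binder, y binder, right associativity) : l2_scope.
Notation "'∃' x .. y , P" := (e_exN (fun x => .. (e_exN (fun y => P)) ..))
  (at level 200, x binder, y binder, right associativity) : l2_scope.
Notation "'∀₂' X .. Y , P" := (e_allS (fun X => .. (e_allS (fun Y => P)) ..))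
  (at level 200, X binder, Y binder, right associativity) : l2_scope.
Notation "'∃₂' X .. Y , P" := (e_exS (fun X => .. (e_exS (fun Y => P)) ..))
  (at level 200, X binder, Y binder, right associativity) : l2_scope.

(** * The system RCA_0 *)

Inductive bounded : form -> Prop :=
| B_fal : bounded Falsum
| B_eq s t : bounded (Equal s t)
| B_lt s t : bounded (Less s t)
| B_mem t X : bounded (Mem t X)
| B_imp p q : bounded p -> bounded q -> bounded (Imp p q)
| B_and p q : bounded p -> bounded q -> bounded (And p q)
| B_or p q : bounded p -> bounded q -> bounded (Or p q)
| B_all t p : bounded p -> bounded (AllNum (Imp (Less (Var 0) (tshift t)) p))
| B_ex t p : bounded p -> bounded (ExNum (And (Less (Var 0) (tshift t)) p)).

Definition Sigma1 (p : form) : Prop := exists q, bounded q /\ p = ExNum q.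
Definition Pi1 (p : form) : Prop := exists q, bounded q /\ p = AllNum q.

Definition basic_axioms : list form :=
  map close
  [ ∀ n, ~ n + 1 = 0;
    ∀ m n, m + 1 = n + 1 -> m = n;
    ∀ m, m + 0 = m;
    ∀ m n, m + (n + 1) = (m + n) + 1;
    ∀ m, m * 0 = 0;
    ∀ m n, m * (n + 1) = m * n + m;
    ∀ m, ~ m < 0;
    ∀ m n, m < n + 1 <-> m <= n ]%L2.

(** [p] with its number variable 0 replaced by its successor. *)
Definition succ_inst (p : form) : form :=
  subst (tcons (Plus (Var 0) One) (fun n => Var (S n))) idS p.

(** The induction and comprehension formulas may contain further free number
    and set variables (parameters).  In comprehension, [shiftS] says that the
    new set variable does not occur in [p]. *)
Inductive RCA0 : form -> Prop :=
| RCA0_basic p : In p basic_axioms -> RCA0 p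
| RCA0_induction p : Sigma1 p ->
    RCA0 (Imp (And (instN Zero p) (AllNum (Imp p (succ_inst p)))) (AllNum p))
| RCA0_comprehension p q : Sigma1 p -> Pi1 q ->
    RCA0 (Imp (AllNum (Iff p q)) (ExSet (AllNum (Iff (Mem (Var 0) 0) (shiftS p))))).

(** * Coding of finite sets and sequences inside second-order arithmetic

    Simpson's coding: (i, j) is (i + j)^2 + i, and (k, (m, n)) represents the
    finite set of the i < k such that m (i + 1) + 1 divides n.  The code of a
    finite set is its least representation, so codes are unique. *)

Local Open Scope l2_scope.

Definition npair (i j : nexp) : nexp := (i + j) * (i + j) + i.

Definition divides (a b : nexp) : fexp := ∃ q, b = a * q.

Definition fmem (i x : nexp) : fexp :=
  ∃ k m n, x = npair k (npair m n) /\ i < k /\ divides (m * (i + 1) + 1) n.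

Definition frep (x : nexp) : fexp := ∃ k m n, x = npair k (npair m n).

Definition fincode (x : nexp) : fexp :=
  frep x /\
  (∀ y, y < x -> frep y -> ~ (∀ i, fmem i x <-> fmem i y)).

Definition len (s l : nexp) : fexp :=
  ∀ i, i < l <-> (∃ j, fmem (npair i j) s).

(** [s] is (the code of) a finite sequence, i.e. of a finite function, viewed
    as a set of pairs, whose domain is an initial segment. *)
Definition finseq (s : nexp) : fexp :=
  fincode s /\
  (∀ x, fmem x s -> ∃ i j, x = npair i j) /\
  (∀ i j k, fmem (npair i j) s -> fmem (npair i k) s -> j = k) /\
  (∃ l, len s l).

Definition binseq (s : nexp) : fexp :=
  finseq s /\ (∀ i j, fmem (npair i j) s -> j = 0 \/ j = 1).

(** Inclusion of graphs: for sequences, [s] is an initial segment of [t]. *)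
Definition fsub (s t : nexp) : fexp := ∀ x, fmem x s -> fmem x t.

Definition card (x k : nexp) : fexp :=
  ∃ s, finseq s /\ len s k /\
    (∀ i j a, fmem (npair i a) s -> fmem (npair j a) s -> i = j) /\
    (∀ a, fmem a x <-> (∃ i, fmem (npair i a) s)).

(** [A] is a definable class, which need not exist as a set. *)
Definition card_le (A : nexp -> fexp) (c : nexp) : fexp :=
  ∀ x, fincode x -> (∀ a, fmem a x -> A a) -> ∃ k, card x k /\ k <= c.

(** * Trees and paths *)

Definition tree (T : sexp) : fexp :=
  (∀ s, s ∈ T -> binseq s) /\
  (∀ s t, t ∈ T -> binseq s -> fsub s t -> s ∈ T).

Definition infinite (X : sexp) : fexp := ~ (∃ k, ∀ i, i ∈ X -> i < k).

Definition extendible (T : sexp) (s : nexp) : fexp :=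
  ∀ m, ∃ t, t ∈ T /\ fsub s t /\ (∃ l, len t l /\ m <= l).

Definition ext_level (T : sexp) (n s : nexp) : fexp :=
  s ∈ T /\ len s n /\ extendible T s.

Definition is_function (f : sexp) : fexp :=
  (∀ x, x ∈ f -> ∃ i j, x = npair i j) /\
  (∀ i, ∃ j, npair i j ∈ f /\ (∀ k, npair i k ∈ f -> k = j)).

(** [s] is the restriction of [f] to the numbers below [n]. *)
Definition restr (f : sexp) (n s : nexp) : fexp :=
  finseq s /\ len s n /\ (∀ i j, fmem (npair i j) s -> npair i j ∈ f).

Definition path (T f : sexp) : fexp :=
  is_function f /\ (∀ n, ∃ s, restr f n s /\ s ∈ T).

Definition WKL_ext_bd : form :=
  close (∀₂ T, tree T -> infinite T ->
           (∃ c, ∀ n, card_le (ext_level T n) c) ->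
           ∃₂ f, path T f).

(* Main.v *)
Require Import Defs.
From Stdlib Require Import List Arith Lia Classical ClassicalEpsilon.
From mathcomp Require filter.
Import ListNotations.

(** In an omega-model of RCA_0 such a tree has only finitely many paths, all of
    them isolated and hence computable from it, so a nonstandard model is needed.

    Fix a nonprincipal ultrafilter on [nat].  For each [i] there is a chain
    [p i 0, ..., p i i] of finite binary trees, each an end extension of the
    previous one, all of whose levels have at most [2 ^ i] nodes and such that the
    top level of [p i k] has at most [2 ^ k].  The numbers of the model are the
    elements of the ultrapower of [nat] that lie below the height of [p _ k] for
    some standard [k]; its sets are those that are Delta_1 in the union [T] of the
    trees.

    Consider a Sigma_1 formula with parameters whose code is below the height of
    [p i k].  The tree [p i (k + 1)] makes it true if any further extension can.
    So on each bounded piece of the model a Sigma_1 class is internal, which gives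
    Sigma_1 induction and, with it, RCA_0.  Moreover [p i (k + 1)] keeps the formula
    from defining a path: all top nodes are split at a position [n]; if the formula
    commits to a value of bit [n] while both halves are alive, that half is killed,
    and otherwise both halves stay alive for ever and the formula never decides bit
    [n].  Only one splitting per stage survives, so the nonstandard number [2 ^ i]
    bounds every level of [T]. *)

(** * A nonprincipal ultrafilter on the natural numbers *)

Lemma nonprincipal_ultrafilter : exists U : (nat -> Prop) -> Prop,
  (forall A B : nat -> Prop, (forall i, A i -> B i) -> U A -> U B) /\
  (forall A B : nat -> Prop, U A -> U B -> U (fun i => A i /\ B i)) /\
  (forall A : nat -> Prop, U A \/ U (fun i => ~ A i)) /\
  (forall A : nat -> Prop, U A -> exists i, A i) /\
  (forall k, U (fun i => k <= i)).
Proof.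
  (* The Frechet filter. An ultrafilter refining it contains every final segment, which is how the
     last clause expresses nonprincipality. *)
  set (F := fun A : nat -> Prop => exists k, forall i, k <= i -> A i).
  assert (FF : filter.ProperFilter F).
  { split.
    - intros [k H]. exact (H k (le_n k)).
    - split.
      + exists 0. intros; exact I.
      + intros A B [k HA] [l HB]. exists (k + l). intros i Hi.
        split; [apply HA | apply HB]; lia.
      + intros A B HAB [k HA]. exists k. intros i Hi. apply HAB, HA, Hi. }
  destruct (@filter.ultraFilterLemma nat F FF) as [U [HU HFU]].
  assert (HP := @filter.ultra_proper _ _ HU).
  exists U. split; [|split; [|split; [|split]]].
  - intros A B HAB HA. exact (@filter.filterS _ _ (@filter.filter_filter _ _ HP) A B HAB HA).
  - intros A B HA HB. exact (@filter.filterI _ _ (@filter.filter_filter _ _ HP) A B HA HB).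
  - intros A. exact (@filter.in_ultra_setVsetC _ _ A HU).
  - intros A HA. exact (@filter.filter_ex _ U HP A HA).
  - intros k. apply HFU. exists k. auto.
Qed.

(** * Soundness *)

(* Equality is interpreted by an arbitrary congruence. *)
Record structure : Type := {
  dom : Type;
  zro : dom;
  one : dom;
  add : dom -> dom -> dom;
  mul : dom -> dom -> dom;
  equ : dom -> dom -> Prop;
  lss : dom -> dom -> Prop;
  sets : Type;
  mem : dom -> sets -> Prop;
  equ_refl : forall x, equ x x;
  equ_sym : forall x y, equ x y -> equ y x;
  equ_trans : forall x y z, equ x y -> equ y z -> equ x z;
  add_equ : forall x y z w, equ x y -> equ z w -> equ (add x z) (add y w);
  mul_equ : forall x y z w, equ x y -> equ z w -> equ (mul x z) (mul y w);
  lss_equ : forall x y z w, equ x y -> equ z w -> lss x z -> lss y w;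
  mem_equ : forall x y X, equ x y -> mem x X -> mem y X }.

Definition cons_env {A} (x : A) (e : nat -> A) (n : nat) : A :=
  match n with 0 => x | S n => e n end.

Section Semantics.
Context (M : structure).

Fixpoint tval (e : nat -> dom M) (t : term) : dom M :=
  match t with
  | Var n => e n
  | Zero => zro M
  | One => one M
  | Plus s t => add M (tval e s) (tval e t)
  | Times s t => mul M (tval e s) (tval e t)
  end.

Fixpoint sat (e : nat -> dom M) (r : nat -> sets M) (p : form) : Prop :=
  match p with
  | Falsum => False
  | Equal s t => equ M (tval e s) (tval e t)
  | Less s t => lss M (tval e s) (tval e t)
  | Mem t X => mem M (tval e t) (r X)
  | Imp p q => sat e r p -> sat e r q
  | And p q => sat e r p /\ sat e r q
  | Or p q => sat e r p \/ sat e r q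
  | AllNum p => forall x, sat (cons_env x e) r p
  | ExNum p => exists x, sat (cons_env x e) r p
  | AllSet p => forall X, sat e (cons_env X r) p
  | ExSet p => exists X, sat e (cons_env X r) p
  end.

Lemma tval_equ e e' t :
  (forall n, equ M (e n) (e' n)) -> equ M (tval e t) (tval e' t).
Proof.
  intros H. induction t; cbn; auto using equ_refl, add_equ, mul_equ.
Qed.

Lemma tval_tsubst sg e t :
  tval e (tsubst sg t) = tval (fun n => tval e (sg n)) t.
Proof. induction t; cbn; congruence. Qed.

(** Number environments are compared up to the congruence, which makes the Leibniz rule sound; set
    environments are compared pointwise, in place of functional extensionality. *)
Lemma sat_equ p : forall e e' r r',
  (forall n, equ M (e n) (e' n)) -> (forall X, r X = r' X) ->
  (sat e r p <-> sat e' r' p).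
Proof.
  assert (cons_equ : forall x e e', (forall n, equ M (e n) (e' n)) ->
      forall n, equ M (cons_env x e n) (cons_env x e' n))
    by (intros x e e' H [|n]; cbn; auto using equ_refl).
  assert (cons_eq : forall (X : sets M) r r', (forall n, r n = r' n) ->
      forall n, cons_env X r n = cons_env X r' n)
    by (intros x e e' H [|n]; cbn; auto).
  induction p; intros e e' r r' He Hr; cbn [sat].
  - tauto.
  - pose proof (tval_equ _ _ s He). pose proof (tval_equ _ _ t He).
    split; intros; eauto using equ_trans, equ_sym.
  - pose proof (tval_equ _ _ s He). pose proof (tval_equ _ _ t He).
    split; intros; eapply lss_equ; eauto using equ_sym.
  - rewrite <- (Hr X). pose proof (tval_equ _ _ t He).
    split; intros; eapply mem_equ; eauto using equ_sym.
  - rewrite (IHp1 e e' r r'), (IHp2 e e' r r') by auto. tauto.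
  - rewrite (IHp1 e e' r r'), (IHp2 e e' r r') by auto. tauto.
  - rewrite (IHp1 e e' r r'), (IHp2 e e' r r') by auto. tauto.
  - split; intros H x; apply (IHp (cons_env x e) (cons_env x e') r r'); auto.
  - split; intros [x H]; exists x; apply (IHp (cons_env x e) (cons_env x e') r r'); auto.
  - split; intros H x; apply (IHp e e' (cons_env x r) (cons_env x r')); auto.
  - split; intros [x H]; exists x; apply (IHp e e' (cons_env x r) (cons_env x r')); auto.
Qed.

Lemma sat_subst p : forall sg rh e r,
  sat e r (subst sg rh p) <-> sat (fun n => tval e (sg n)) (fun X => r (rh X)) p.
Proof.
  assert (upN_equ : forall sg e x n, equ M (tval (cons_env x e) (upN sg n))
      (cons_env x (fun n => tval e (sg n)) n)).
  { intros sg e x [|n]; cbn; [apply equ_refl|].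
    unfold tshift. rewrite tval_tsubst. apply equ_refl. }
  assert (upS_eq : forall rh (r : nat -> sets M) X n,
      cons_env X r (upS rh n) = cons_env X (fun n => r (rh n)) n)
    by (intros rh r X [|n]; reflexivity).
  induction p; intros sg rh e r; cbn [sat subst].
  - tauto.
  - rewrite !tval_tsubst. tauto.
  - rewrite !tval_tsubst. tauto.
  - rewrite !tval_tsubst. tauto.
  - rewrite IHp1, IHp2. tauto.
  - rewrite IHp1, IHp2. tauto.
  - rewrite IHp1, IHp2. tauto.
  - split; intros H x; specialize (H x); [rewrite IHp in H|rewrite IHp];
      (eapply sat_equ; [| |exact H]); intros; cbn;
      auto using equ_sym.
  - split; intros [x H]; exists x; [rewrite IHp in H|rewrite IHp];
      (eapply sat_equ; [| |exact H]); intros; cbn;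
      auto using equ_sym.
  - split; intros H x; specialize (H x); [rewrite IHp in H|rewrite IHp];
      (eapply sat_equ; [| |exact H]); intros; cbn;
      auto using equ_refl.
  - split; intros [x H]; exists x; [rewrite IHp in H|rewrite IHp];
      (eapply sat_equ; [| |exact H]); intros; cbn;
      auto using equ_refl.
Qed.

Lemma sat_shiftN x e r p : sat (cons_env x e) r (shiftN p) <-> sat e r p.
Proof. unfold shiftN. rewrite sat_subst. reflexivity. Qed.

Lemma sat_shiftS X e r p : sat e (cons_env X r) (shiftS p) <-> sat e r p.
Proof. unfold shiftS. rewrite sat_subst. reflexivity. Qed.

Lemma sat_instN t e r p : sat e r (instN t p) <-> sat (cons_env (tval e t) e) r p.
Proof.
  unfold instN. rewrite sat_subst. apply sat_equ; [|reflexivity].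
  intros [|n]; apply equ_refl.
Qed.

Lemma sat_instS X e r p : sat e r (instS X p) <-> sat e (cons_env (r X) r) p.
Proof.
  unfold instS. rewrite sat_subst. apply sat_equ; [intros; apply equ_refl|].
  intros [|n]; reflexivity.
Qed.

(** Axioms are assumed true under every assignment: a derivation may invoke them below eigenvariable
    rules, where the assignment has changed. *)
Theorem soundness (Ax : form -> Prop) (G : list form) (p : form) :
  deriv Ax G p ->
  (forall q, Ax q -> forall e r, sat e r q) ->
  forall e r, (forall q, In q G -> sat e r q) -> sat e r p.
Proof.
  intros HD HAx.
  assert (shN : forall G e r x, (forall q, In q G -> sat e r q) ->
      forall q, In q (map shiftN G) -> sat (cons_env x e) r q).
  { intros G0 e r x H q Hq. apply in_map_iff in Hq as [q' [<- Hq]].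
    rewrite sat_shiftN. auto. }
  assert (shS : forall G e r X, (forall q, In q G -> sat e r q) ->
      forall q, In q (map shiftS G) -> sat e (cons_env X r) q).
  { intros G0 e r x H q Hq. apply in_map_iff in Hq as [q' [<- Hq]].
    rewrite sat_shiftS. auto. }
  assert (cns : forall G p e r, sat e r p -> (forall q, In q G -> sat e r q) ->
      forall q, In q (p :: G) -> sat e r q)
    by (intros G0 p0 e r H1 H2 q [<-|Hq]; auto).
  induction HD; intros e rho HG; cbn [sat] in *.
  - auto.
  - auto.
  - apply NNPP. intros Hp. apply (IHHD e rho). apply cns; auto.
  - intros Hp. apply IHHD, cns; auto.
  - apply (IHHD1 e rho HG). auto.
  - split; auto.
  - apply (IHHD e rho HG).
  - apply (IHHD e rho HG).
  - left; auto.
  - right; auto.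
  - destruct (IHHD1 e rho HG); [apply IHHD2|apply IHHD3]; apply cns; auto.
  - intros x. apply IHHD, shN, HG.
  - rewrite sat_instN. apply (IHHD e rho HG).
  - exists (tval e t). rewrite <- sat_instN. auto.
  - destruct (IHHD1 e rho HG) as [x Hx]. apply (sat_shiftN x).
    apply IHHD2, (cns _ _ _ _ Hx), shN, HG.
  - intros X. apply IHHD, shS, HG.
  - rewrite sat_instS. apply (IHHD e rho HG).
  - exists (rho X). rewrite <- sat_instS. auto.
  - destruct (IHHD1 e rho HG) as [x Hx]. apply (sat_shiftS x).
    apply IHHD2, (cns _ _ _ _ Hx), shS, HG.
  - apply equ_refl.
  - specialize (IHHD1 e rho HG). specialize (IHHD2 e rho HG).
    rewrite sat_instN in *. eapply sat_equ; [| |exact IHHD2]; [|reflexivity].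
    intros [|n]; cbn; auto using equ_refl, equ_sym.
Qed.

End Semantics.

(** * Finite sets and binary strings coded by numbers *)

(** From here to [bincode] the definitions read the coding formulas, from [npair] to [binseq], over
    the standard numbers, so that they can later be transferred coordinate by coordinate. *)
Definition pr (i j : nat) : nat := (i + j) * (i + j) + i.

(** The number [pr i j] lies between the square of [i + j] and the next square. This determines
    [i + j], and the remainder is [i]. *)
Lemma pr_inj i j i' j' : pr i j = pr i' j' -> i = i' /\ j = j'.
Proof.
  unfold pr. intros H.
  assert (i + j = i' + j').
  { destruct (Nat.lt_trichotomy (i + j) (i' + j')) as [L|[L|L]]; [|exact L|]; exfalso; nia. }
  assert (i = i') by nia. lia.
Qed.

Lemma pr_le i j i' j' : i <= i' -> j <= j' -> pr i j <= pr i' j'.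
Proof. unfold pr. nia. Qed.

Lemma pr_fst i j : i <= pr i j.
Proof. unfold pr. nia. Qed.

Lemma pr_snd i j : j <= pr i j.
Proof. unfold pr. nia. Qed.

Definition dvd (a b : nat) : Prop := exists q, b = a * q.

Definition inset (a x : nat) : Prop :=
  exists k m n, x = pr k (pr m n) /\ a < k /\ dvd (m * (a + 1) + 1) n.

Definition setrep (x : nat) : Prop := exists k m n, x = pr k (pr m n).

Definition setcode (x : nat) : Prop :=
  setrep x /\ forall y, y < x -> setrep y -> ~ (forall a, inset a x <-> inset a y).

Definition haslen (s l : nat) : Prop := forall i, i < l <-> exists j, inset (pr i j) s.

Definition seqcode (s : nat) : Prop :=
  setcode s /\
  (forall x, inset x s -> exists i j, x = pr i j) /\
  (forall i j k, inset (pr i j) s -> inset (pr i k) s -> j = k) /\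
  (exists l, haslen s l).

Definition bincode (s : nat) : Prop :=
  seqcode s /\ (forall i j, inset (pr i j) s -> j = 0 \/ j = 1).

Lemma inset_lt a x : inset a x -> a < x.
Proof.
  intros (k & m & n & -> & H & _). pose proof (pr_fst k (pr m n)). lia.
Qed.

Lemma inset_pr a k m n :
  inset a (pr k (pr m n)) <-> a < k /\ dvd (m * (a + 1) + 1) n.
Proof.
  split.
  - intros (k' & m' & n' & E & H).
    apply pr_inj in E as [<- E]. apply pr_inj in E as [<- <-]. exact H.
  - intros H. exists k, m, n. auto.
Qed.

Lemma dvd_divide a b : dvd a b <-> Nat.divide a b.
Proof.
  split; intros [q H]; exists q; lia.
Qed.

Lemma fact_dvd n d : 1 <= d <= n -> Nat.divide d (fact n).
Proof.
  induction n; intros H; [lia|].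
  destruct (Nat.eq_dec d (S n)) as [->|E].
  - exists (fact n). cbn [fact]. lia.
  - destruct IHn as [q Hq]; [lia|]. exists (S n * q). cbn [fact]. rewrite Hq. lia.
Qed.

(** Goedel's beta function: a common divisor of the two moduli is coprime to [m = k!] and divides
    [m * (b - a)], hence divides [b - a], which is at most [k] and so divides [m]; it is therefore
    1. *)
Lemma beta_coprime k a b : a < b -> b < k ->
  Nat.gcd (fact k * (a + 1) + 1) (fact k * (b + 1) + 1) = 1.
Proof.
  intros Hab Hb. set (m := fact k). set (g := Nat.gcd _ _).
  assert (Ga : Nat.divide g (m * (a + 1) + 1)) by apply Nat.gcd_divide_l.
  assert (Gb : Nat.divide g (m * (b + 1) + 1)) by apply Nat.gcd_divide_r.
  assert (Gm : Nat.gcd g m = 1).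
  { apply Nat.divide_1_r.
    apply (Nat.divide_add_cancel_r _ (m * (a + 1)) 1).
    - apply Nat.divide_mul_l, Nat.gcd_divide_r.
    - eapply Nat.divide_trans; [apply Nat.gcd_divide_l|exact Ga]. }
  assert (Gd : Nat.divide g (m * (b - a))).
  { apply (Nat.divide_add_cancel_r _ (m * (a + 1) + 1)); [exact Ga|].
    replace (m * (a + 1) + 1 + m * (b - a)) with (m * (b + 1) + 1) by nia. exact Gb. }
  apply Nat.gauss in Gd; [|exact Gm].
  assert (Nat.divide g m).
  { eapply Nat.divide_trans; [exact Gd|]. apply fact_dvd. lia. }
  apply Nat.divide_1_r.
  apply (Nat.divide_add_cancel_r _ (m * (a + 1)) 1); [|exact Ga].
  apply Nat.divide_mul_l. assumption.
Qed.

Lemma coprime_divide_prod (f : nat -> nat) d l :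
  (forall a, In a l -> Nat.gcd d (f a) = 1) ->
  Nat.divide d (fold_right (fun a n => f a * n) 1 l) -> d = 1.
Proof.
  induction l as [|a l IH]; cbn; intros H D.
  - apply Nat.divide_1_r, D.
  - apply IH; [auto|]. eapply Nat.gauss; [exact D|]. auto.
Qed.

Lemma divide_prod (f : nat -> nat) a l :
  In a l -> Nat.divide (f a) (fold_right (fun a n => f a * n) 1 l).
Proof.
  induction l as [|b l IH]; [intros []|]. cbn. intros [->|Ha].
  - apply Nat.divide_mul_l, Nat.divide_refl.
  - apply Nat.divide_mul_r. auto.
Qed.

(** The multiplier is [k!] for a [k] above all members, and [n] is the product of the moduli of the
    members. The modulus of a non-member below [k] exceeds 1 and is coprime to that product. *)
Lemma setrep_exists (l : list nat) :
  exists x, setrep x /\ forall a, inset a x <-> In a l.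
Proof.
  set (k := S (list_max l)).
  set (f := fun a => fact k * (a + 1) + 1).
  set (n := fold_right (fun a n => f a * n) 1 l).
  assert (Hk : forall a, In a l -> a < k).
  { intros a Ha. unfold k.
    pose proof (proj1 (list_max_le l (list_max l)) (le_n _)) as F.
    rewrite Forall_forall in F. specialize (F a Ha). lia. }
  assert (Hfact : fact k <> 0) by apply fact_neq_0.
  exists (pr k (pr (fact k) n)). split; [exists k, (fact k), n; reflexivity|].
  intros a. rewrite inset_pr, dvd_divide. split.
  - intros [Ha D]. apply NNPP. intros N.
    apply (coprime_divide_prod f) in D.
    + unfold f in D. nia.
    + intros b Hb. assert (b <> a) by (intros ->; auto).
      destruct (Nat.lt_ge_cases a b).
      * apply beta_coprime; auto.
      * rewrite Nat.gcd_comm. apply beta_coprime; auto. lia.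
  - intros Ha. split; [auto|]. apply (divide_prod f), Ha.
Qed.

Lemma least_nat (P : nat -> Prop) n : P n -> exists m, m <= n /\ P m /\ forall k, k < m -> ~ P k.
Proof.
  induction n as [n IH] using lt_wf_ind. intros Hn.
  destruct (classic (exists k, k < n /\ P k)) as [(k & Hk & Pk)|N].
  - destruct (IH k Hk Pk) as (m & ? & ? & ?). exists m. repeat split; auto. lia.
  - exists n. repeat split; auto. intros k Hk Pk. apply N. eauto.
Qed.

Lemma setcode_exists (l : list nat) :
  exists x, setcode x /\ forall a, inset a x <-> In a l.
Proof.
  destruct (setrep_exists l) as [x0 H0].
  destruct (least_nat (fun x => setrep x /\ forall a, inset a x <-> In a l) x0 H0)
    as (x & _ & [Hr Hx] & Hm).
  exists x. split; [split|]; auto.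
  intros y Hy Ry E. apply (Hm y Hy). split; [auto|]. intros a. rewrite <- E. auto.
Qed.

Lemma setcode_unique x y :
  setcode x -> setcode y -> (forall a, inset a x <-> inset a y) -> x = y.
Proof.
  intros [Rx Mx] [Ry My] E.
  destruct (Nat.lt_trichotomy x y) as [L|[L|L]]; auto; exfalso.
  - apply (My x L Rx). intros a. symmetry. auto.
  - apply (Mx y L Ry). auto.
Qed.

Fixpoint sublists (n : nat) : list (list nat) :=
  match n with
  | 0 => [[]]
  | S n => sublists n ++ map (cons n) (sublists n)
  end.

Lemma sublists_complete (P : nat -> Prop) n : (forall a, P a -> a < n) ->
  exists l, In l (sublists n) /\ forall a, In a l <-> P a.
Proof.
  revert P. induction n; intros P H.
  - exists []. split; [left; auto|]. intros a.
    split; [intros []|]. intros Ha. specialize (H a Ha). lia.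
  - destruct (IHn (fun a => P a /\ a <> n)) as (l & Hl & E).
    { intros a [Ha N]. specialize (H a Ha). lia. }
    cbn. destruct (classic (P n)) as [Pn|Pn].
    + exists (n :: l). split; [apply in_or_app; right; apply in_map; auto|].
      intros a. cbn. rewrite E. split.
      * intros [->|[? ?]]; auto.
      * intros Ha. destruct (Nat.eq_dec n a); auto.
    + exists l. split; [apply in_or_app; left; auto|].
      intros a. rewrite E. split; [intros [? _]; auto|]. intros Ha. split; auto. congruence.
Qed.

(** A set code is determined by its members, and the numbers below [n] have only finitely many
    subsets. The bound enters [growth], so that the cut contains codes for its internal finite
    sets. *)
Lemma setcode_bound : exists cb : nat -> nat,
  (forall n x, setcode x -> (forall a, inset a x -> a < n) -> x <= cb n) /\
  (forall n m, n <= m -> cb n <= cb m).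
Proof.
  assert (B : forall n, exists b, forall x, setcode x -> (forall a, inset a x -> a < n) -> x <= b).
  { intros n.
    assert (C : exists b, forall l x, In l (sublists n) -> setcode x ->
                  (forall a, inset a x <-> In a l) -> x <= b).
    { generalize (sublists n). intros L. induction L as [|l L [b IH]].
      - exists 0. intros ? ? [].
      - destruct (setcode_exists l) as (y & Hy & Ey). exists (b + y).
        intros l' x [<-|Hl] Hx Ex.
        + rewrite (setcode_unique x y Hx Hy); [lia|]. intros a. rewrite Ex, Ey. reflexivity.
        + specialize (IH l' x Hl Hx Ex). lia. }
    destruct C as [b C]. exists b. intros x Hx Hn.
    destruct (sublists_complete (fun a => inset a x) n Hn) as (l & Hl & E).
    apply (C l x Hl Hx). intros a. symmetry. auto. }
  apply choice in B as [f Hf].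
  (* Summing the bounds for all arguments up to [n] makes the bound monotone. *)
  exists (fun n => fold_right (fun m s => f m + s) 0 (seq 0 (S n))).
  split.
  - intros n x Hx Hn. specialize (Hf n x Hx Hn). rewrite seq_S, fold_right_app. cbn.
    assert (G : forall l b, b <= fold_right (fun m s => f m + s) b l)
      by (induction l; cbn; intros; [lia|]; specialize (IHl b); lia).
    specialize (G (seq 0 n) (f n + 0)). lia.
  - intros n m H. replace (S m) with (S n + (m - n)) by lia.
    rewrite seq_app, fold_right_app.
    assert (G : forall l b,
        fold_right (fun m s => f m + s) 0 l <= fold_right (fun m s => f m + s) b l)
      by (induction l; cbn; intros; [lia|]; specialize (IHl b); lia).
    apply G.
Qed.

Definition bit (b : bool) : nat := if b then 1 else 0.

Definition strcode (w : list bool) (s : nat) : Prop :=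
  setcode s /\
  forall x, inset x s <-> exists i, i < length w /\ x = pr i (bit (nth i w false)).

Lemma strcode_inset w s i j :
  strcode w s -> (inset (pr i j) s <-> i < length w /\ j = bit (nth i w false)).
Proof.
  intros [_ H]. rewrite H. split.
  - intros (i' & L & E). apply pr_inj in E as [-> ->]. auto.
  - intros [L ->]. eauto.
Qed.

Lemma strcode_haslen w s l : strcode w s -> (haslen s l <-> l = length w).
Proof.
  intros H. split.
  - intros L. unfold haslen in L.
    assert (E : forall i, i < l <-> i < length w).
    { intros i. rewrite L. split.
      - intros [j Hj]. apply (strcode_inset w s i j H) in Hj. tauto.
      - intros Hi. exists (bit (nth i w false)). apply (strcode_inset w s _ _ H). auto. }
    pose proof (E l). pose proof (E (length w)). lia.
  - intros -> i. split.
    + intros Hi. exists (bit (nth i w false)). apply (strcode_inset w s _ _ H). auto.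
    + intros [j Hj]. apply (strcode_inset w s i j H) in Hj. tauto.
Qed.

Lemma bit_inj b c : bit b = bit c -> b = c.
Proof. destruct b, c; cbn; congruence. Qed.

Lemma strcode_exists w : exists s, strcode w s.
Proof.
  destruct (setcode_exists (map (fun i => pr i (bit (nth i w false))) (seq 0 (length w))))
    as (s & Hs & E).
  exists s. split; auto. intros x. rewrite E, in_map_iff. split.
  - intros (i & <- & Hi). apply in_seq in Hi. exists i. split; auto. lia.
  - intros (i & Hi & ->). exists i. rewrite in_seq. split; auto. lia.
Qed.

Lemma strcode_bincode w s : strcode w s -> bincode s.
Proof.
  intros H. split; [split; [apply H|split; [|split]]|].
  - intros x Hx. apply H in Hx as (i & _ & ->). eauto.
  - intros i j k Hj Hk. apply (strcode_inset _ _ _ _ H) in Hj, Hk. destruct Hj, Hk. congruence.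
  - exists (length w). apply (strcode_haslen w s _ H). reflexivity.
  - intros i j Hj. apply (strcode_inset _ _ _ _ H) in Hj as [_ ->].
    destruct nth; cbn; auto.
Qed.

Lemma bincode_strcode s : bincode s -> exists w, strcode w s.
Proof.
  intros [(Hs & Hp & Hf & l & Hl) Hb].
  assert (F : forall i, exists b, i < l -> inset (pr i (bit b)) s).
  { intros i. destruct (classic (i < l)) as [L|L]; [|exists false; tauto].
    apply Hl in L as [j Hj]. destruct (Hb i j Hj) as [-> | ->].
    - exists false. auto.
    - exists true. auto. }
  apply choice in F as [f F].
  exists (map f (seq 0 l)). split; auto. intros x. rewrite length_map, length_seq.
  assert (N : forall i, i < l -> nth i (map f (seq 0 l)) false = f i).
  { intros i Hi. rewrite (nth_indep _ false (f 0)) by (rewrite length_map, length_seq; auto).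
    rewrite map_nth, seq_nth by auto. reflexivity. }
  split.
  - intros Hx. destruct (Hp x Hx) as (i & j & ->).
    assert (L : i < l) by (apply Hl; eauto).
    exists i. rewrite N by auto. split; auto. f_equal. apply (Hf i); auto.
  - intros (i & L & ->). rewrite N by auto. auto.
Qed.

Lemma strcode_prefix v w s t : strcode v s -> strcode w t ->
  (forall x, inset x s -> inset x t) -> exists u, w = v ++ u.
Proof.
  intros Hs Ht H.
  assert (E : forall i, i < length v -> i < length w /\ nth i v false = nth i w false).
  { intros i Hi.
    assert (X : inset (pr i (bit (nth i v false))) s) by (apply (strcode_inset _ _ _ _ Hs); auto).
    apply H, (strcode_inset _ _ _ _ Ht) in X as [L B]. split; auto. apply bit_inj, B. }
  assert (L : length v <= length w).
  { destruct (length v) as [|n] eqn:Lv; [lia|]. destruct (E n); lia. }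
  exists (skipn (length v) w). rewrite <- (firstn_skipn (length v) w) at 1. f_equal.
  apply (nth_ext _ _ false false).
  - rewrite length_firstn. lia.
  - intros i Hi. rewrite length_firstn in Hi.
    rewrite nth_firstn. destruct (Nat.ltb_spec i (length v)); [|lia].
    symmetry. apply E. lia.
Qed.

Lemma strcode_fun w s t : strcode w s -> strcode w t -> s = t.
Proof.
  intros [Hs Es] [Ht Et]. apply setcode_unique; auto. intros a. rewrite Es, Et. reflexivity.
Qed.

(** The last position of [w] occurs in a pair that is a member of [s], and members lie below codes.
    Hence a number below the height of a condition can only code strings that the condition has
    settled. *)
Lemma strcode_length w s : strcode w s -> length w <= s.
Proof.
  intros H. destruct (length w) as [|n] eqn:L; [lia|].
  assert (X : inset (pr n (bit (nth n w false))) s).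
  { apply (strcode_inset _ _ _ _ H). split; auto. lia. }
  apply inset_lt in X. pose proof (pr_fst n (bit (nth n w false))). lia.
Qed.

Lemma strcode_entries w s x : strcode w s -> inset x s -> x < S (pr (length w) 1).
Proof.
  intros H Hx. apply H in Hx as (i & Hi & ->).
  assert (bit (nth i w false) <= 1) by (destruct nth; cbn; auto).
  pose proof (pr_le i (bit (nth i w false)) (length w) 1). lia.
Qed.

(** The enumeration is the witness that [card] asks for. The final clause bounds its entries, so
    that [cb] bounds its code. *)
Lemma enumeration_code (l : list nat) n : NoDup l -> (forall a, In a l -> a < n) ->
  exists s, seqcode s /\ haslen s (length l) /\
    (forall i j a, inset (pr i a) s -> inset (pr j a) s -> i = j) /\
    (forall a, In a l <-> exists i, inset (pr i a) s) /\
    (forall x, inset x s -> x < S (pr (length l) n)).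
Proof.
  intros ND Hn.
  destruct (setcode_exists (map (fun i => pr i (nth i l 0)) (seq 0 (length l)))) as (s & Hs & E).
  assert (In_s : forall i a, inset (pr i a) s <-> i < length l /\ a = nth i l 0).
  { intros i a. rewrite E, in_map_iff. split.
    - intros (i' & Ei & Hi). apply in_seq in Hi. apply pr_inj in Ei as [<- <-]. split; auto. lia.
    - intros [L ->]. exists i. rewrite in_seq. split; auto. lia. }
  assert (HL : haslen s (length l)).
  { intros i. split.
    - intros L. exists (nth i l 0). apply In_s. auto.
    - intros [j Hj]. apply In_s in Hj. tauto. }
  exists s. split; [split; [auto|split; [|split; [|eauto]]]|split; [auto|split; [|split]]].
  - intros x Hx. apply E, in_map_iff in Hx as (i & <- & _). eauto.
  - intros i j k Hj Hk. apply In_s in Hj, Hk. destruct Hj, Hk. congruence.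
  - intros i j a Hi Hj. apply In_s in Hi, Hj. destruct Hi as [Li ->], Hj as [Lj Ej].
    eapply NoDup_nth; eauto.
  - intros a. split.
    + intros Ha. apply (In_nth _ _ 0) in Ha as (i & Li & <-). exists i. apply In_s. auto.
    + intros [i Hi]. apply In_s in Hi as [Li ->]. apply nth_In. auto.
  - intros x Hx. apply E, in_map_iff in Hx as (i & <- & Hi). apply in_seq in Hi.
    assert (Ha : In (nth i l 0) l) by (apply nth_In; lia). apply Hn in Ha.
    pose proof (pr_le i (nth i l 0) (length l) n). lia.
Qed.

(** * Finite trees and the stage construction *)

(* Sigma_1 formulas about a tree, closed under bounded quantification and
   explicit substitution; [SIn] and [SOut] express membership in the tree and its
   negation.  Variables are read off a list, with value 0 beyond its end. *)
Inductive sig : Type :=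
| SEq (s t : term)
| SLt (s t : term)
| SIn (t : term)
| SOut (t : term)
| SAnd (p q : sig)
| SOr (p q : sig)
| SAll (t : term) (p : sig)
| SEx (p : sig)
| SSub (l : list term) (p : sig).

Fixpoint teval (e : list nat) (t : term) : nat :=
  match t with
  | Var n => nth n e 0
  | Zero => 0
  | One => 1
  | Plus s t => teval e s + teval e t
  | Times s t => teval e s * teval e t
  end.

(** A forcing condition: a tree cut off at height [ht]. [node] is an arbitrary predicate, and [wf]
    makes it a tree of bounded width. *)
Record cond : Type := { ht : nat; node : list bool -> Prop }.

(* What the part [p] of a tree already guarantees: [SOut] needs a string that [p]
   is tall enough to have excluded, and [SEx] a witness below the height. *)
Fixpoint eval (p : cond) (f : sig) (e : list nat) : Prop :=
  match f with
  | SEq s t => teval e s = teval e t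
  | SLt s t => teval e s < teval e t
  | SIn t => exists w, strcode w (teval e t) /\ node p w
  | SOut t => forall w, strcode w (teval e t) -> length w <= ht p /\ ~ node p w
  | SAnd f g => eval p f e /\ eval p g e
  | SOr f g => eval p f e \/ eval p g e
  | SAll t f => forall y, y < teval e t -> eval p f (y :: e)
  | SEx f => exists y, y < ht p /\ eval p f (y :: e)
  | SSub l f => eval p f (map (teval e) l)
  end.

Definition endext (p q : cond) : Prop :=
  ht p <= ht q /\ forall w, length w <= ht p -> (node p w <-> node q w).

Definition top (p : cond) (w : list bool) : Prop := node p w /\ length w = ht p.

(** No top node of [p] may die. In the diagonalization this keeps both values of a bit alive until a
    formula commits to one of them. *)
Definition ext (p q : cond) : Prop :=
  endext p q /\ forall w, top p w -> exists u, top q (w ++ u).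

Definition wf (c : nat) (p : cond) : Prop :=
  (forall w, node p w -> length w <= ht p) /\
  (forall u v, node p (u ++ v) -> node p u) /\
  (forall n l, NoDup l -> (forall w, In w l -> node p w /\ length w = n) -> length l <= c).

(** Two separate bounds: [c] for all levels at once, and [k] for the top level, from which
    everything later branches off. *)
Definition good (k c : nat) (p : cond) : Prop :=
  wf c p /\ exists l, l <> [] /\ (forall w, In w l <-> top p w) /\ length l <= k.

Lemma endext_refl p : endext p p.
Proof. split; [lia|tauto]. Qed.

Lemma endext_trans p q r : endext p q -> endext q r -> endext p r.
Proof.
  intros [H1 E1] [H2 E2]. split; [lia|]. intros w L. rewrite E1, E2 by lia. tauto.
Qed.

Lemma ext_refl p : ext p p.
Proof.
  split; [apply endext_refl|]. intros w H. exists []. rewrite app_nil_r. auto.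
Qed.

Lemma ext_trans p q r : ext p q -> ext q r -> ext p r.
Proof.
  intros [E1 T1] [E2 T2]. split; [eapply endext_trans; eauto|].
  intros w H. destruct (T1 w H) as [u Hu]. destruct (T2 _ Hu) as [v Hv].
  exists (u ++ v). rewrite app_assoc. auto.
Qed.

(** What counts as true concerns strings within the height of [p], where [q] agrees with it, or
    witnesses below that height. [wf] supplies the length bound for [SIn], while [SOut] carries its
    own. *)
Lemma eval_mono c p q f : forall e,
  wf c p -> endext p q -> eval p f e -> eval q f e.
Proof.
  intros e W [Hh Hn]. revert e.
  induction f; intros e; cbn; auto.
  - intros (w & Hw & N). exists w. split; auto. apply Hn; [apply W|]; auto.
  - intros H w Hw. destruct (H w Hw) as [L N]. split; [lia|].
    rewrite <- Hn by auto. auto.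
  - intros [? ?]; auto.
  - intros [?|?]; auto.
  - intros (y & L & H). exists y. split; [lia|auto].
Qed.

Definition add_level (q : cond) (l : list (list bool)) : cond :=
  {| ht := S (ht q); node w := node q w \/ In w l |}.

(** The new strings are longer than all nodes of [q], so no old level gets wider, and their proper
    prefixes are prefixes of top nodes of [q]. *)
Lemma add_level_good k c q l :
  wf c q -> l <> [] -> length l <= k -> k <= c ->
  (forall w, In w l -> exists v b, w = v ++ [b] /\ top q v) ->
  good k c (add_level q l).
Proof.
  intros (W1 & W2 & W3) Hl Lk Lc H.
  assert (Len : forall w, In w l -> length w = S (ht q)).
  { intros w Hw. destruct (H w Hw) as (v & b & -> & _ & L). rewrite length_app. cbn. lia. }
  split; [split; [|split]|].
  - cbn. intros w [N|I]; [apply W1 in N; lia|]. rewrite (Len w I). lia.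
  - cbn. intros u v [N|I]; [left; eapply W2; eauto|].
    destruct v as [|b v _] using rev_ind; [rewrite app_nil_r in I; auto|].
    destruct (H _ I) as (v' & b' & E & N & _). rewrite app_assoc in E.
    apply app_inj_tail in E as [<- _]. left. eapply W2; eauto.
  - cbn. intros n m ND Hm. destruct (Nat.le_gt_cases n (ht q)).
    + apply (W3 n m ND). intros w Hw. destruct (Hm w Hw) as [[N|I] E]; auto.
      apply Len in I. lia.
    + assert (length m <= length l); [|lia]. apply NoDup_incl_length; auto.
      intros w Hw. destruct (Hm w Hw) as [[N|I] E]; auto. apply W1 in N. lia.
  - exists l. split; [auto|split; [|auto]]. intros w. unfold top. cbn. split.
    + intros I. split; auto.
    + intros [[N|I] E]; auto. apply W1 in N. lia.
Qed.

Lemma add_level_endext c q l :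
  wf c q -> (forall w, In w l -> exists v b, w = v ++ [b] /\ top q v) -> endext q (add_level q l).
Proof.
  intros W H. split; cbn; [lia|]. intros w L. split; [auto|]. intros [N|I]; auto.
  destruct (H w I) as (v & b & -> & _ & E). rewrite length_app in L. cbn in L. lia.
Qed.

(* An extension [q] of [p] may be wide at the top; thinning it out just above
   the top keeps what [q] decides but brings the width back to that of [p]. *)
Lemma prune k c p q (sel : list bool -> Prop) :
  good k c p -> wf c q -> endext p q -> k <= c ->
  (forall w, top p w -> exists u, sel (w ++ u) /\ top q (w ++ u)) ->
  exists r, good k c r /\ ext p r /\ endext q r /\ ht q < ht r /\
    (forall w, top r w -> exists v, sel v /\ top q v /\ w = v ++ [false]).
Proof.
  intros (Wp & l & Hl & Tl & Lk) Wq E Kc S.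
  assert (S' : forall w, exists u, top p w -> sel (w ++ u) /\ top q (w ++ u)).
  { intros w. destruct (classic (top p w)) as [T|T]; [|exists []; tauto].
    destruct (S w T) as [u Hu]. exists u. auto. }
  apply choice in S' as [F HF].
  (* One selected top node of [q] per top node of [p] keeps the new level as narrow as the top of
     [p]; the appended bit makes the height grow strictly. *)
  set (l' := map (fun w => (w ++ F w) ++ [false]) l).
  assert (Hl' : forall w, In w l' -> exists v, sel v /\ top q v /\ w = v ++ [false]).
  { intros w Hw. apply in_map_iff in Hw as (w0 & <- & I). apply Tl in I.
    exists (w0 ++ F w0). destruct (HF w0 I). auto. }
  assert (Hl'' : forall w, In w l' -> exists v b, w = v ++ [b] /\ top q v).
  { intros w Hw. destruct (Hl' w Hw) as (v & _ & T & ->). eauto. }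
  assert (G : good k c (add_level q l')).
  { apply add_level_good; auto.
    - unfold l'. destruct l; cbn; [auto|discriminate].
    - unfold l'. rewrite length_map. auto. }
  assert (E' : endext q (add_level q l')) by (eapply add_level_endext; eauto).
  exists (add_level q l'). split; [auto|split; [split|split; [auto|split; [cbn; auto|]]]].
  - eapply endext_trans; eauto.
  - intros w T. exists (F w ++ [false]). rewrite app_assoc.
    destruct (HF w T) as [_ [N L]]. split.
    + right. apply in_map_iff. exists w. split; auto. apply Tl, T.
    + cbn. rewrite length_app. cbn. lia.
  - intros w [[N|I] L]; [|auto]. apply Wq in N. cbn in L. lia.
Qed.

(** Pruning a condition over itself with the trivial selection raises its height without widening
    the top. *)
Lemma grow k c p n : k <= c -> good k c p -> exists r, good k c r /\ ext p r /\ n <= ht r.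
Proof.
  intros Kc G. induction n as [|n (r & Gr & Er & Hr)].
  - exists p. auto using ext_refl with arith.
  - destruct (prune k c r r (fun _ => True)) as (r' & Gr' & Er' & _ & H & _); auto.
    + apply Gr.
    + apply endext_refl.
    + intros w T. exists []. rewrite app_nil_r. auto.
    + exists r'. split; [auto|split; [eapply ext_trans; eauto|lia]].
Qed.

(** The pairs are treated one after another: whenever some extension makes the current pair true,
    such an extension is taken and pruned. It ranges over all trees of width [c], because the tops
    of later stages are wider than [k]. What has been made true stays true by [eval_mono]. *)
Lemma decide k c p (L : list (sig * list nat)) : k <= c -> good k c p ->
  exists r, good k c r /\ ext p r /\
    forall f e, In (f, e) L -> forall s, wf c s -> ext r s -> eval s f e -> eval r f e.
Proof.
  intros Kc G. induction L as [|[f e] L (r & Gr & Er & Hr)].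
  - exists p. split; [auto|split; [apply ext_refl|]]. intros ? ? [].
  - destruct (classic (exists s, wf c s /\ ext r s /\ eval s f e)) as [(s & Ws & Es & Hs)|N].
    + destruct (prune k c r s (fun _ => True)) as (r' & Gr' & Er' & Es' & _); auto.
      * apply Es.
      * intros w T. destruct (proj2 Es w T) as [u Hu]. eauto.
      * exists r'. split; [auto|split; [eapply ext_trans; eauto|]].
        intros f' e' [[= <- <-]|I] s' Ws' Ess' Hs'.
        -- apply (eval_mono c s); auto.
        -- apply (eval_mono c r); [apply Gr|apply Er'|].
           apply (Hr f' e' I s'); auto. eapply ext_trans; eauto.
    + exists r. split; [auto|split; [auto|]].
      intros f' e' [[= <- <-]|I] s' Ws' Ess' Hs'; [|eauto].
      exfalso. apply N. eauto.
Qed.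

(* Either [f] commits to a value of bit [n] that no top node has, or it never
   commits at all. *)
Definition beats (c : nat) (p : cond) (f : sig) (e : list nat) : Prop :=
  exists n, n < ht p /\
   ((exists v, eval p f (pr n (bit v) :: e) /\ forall w, top p w -> nth n w false <> v) \/
    (forall v q, wf c q -> ext p q -> ~ eval q f (pr n (bit v) :: e))).

(** Truncating a top node of [q] to length [ht p] gives a top node of [p] with the same bit [n], so
    the first alternative persists; the second passes to extensions by transitivity. *)
Lemma beats_ext c p q f e : wf c p -> wf c q -> ext p q -> beats c p f e -> beats c q f e.
Proof.
  intros Wp Wq E (n & Hn & H). pose proof E as [[Hh Nd] T].
  exists n. split; [lia|]. destruct H as [(v & Hv & H)|H].
  - left. exists v. split; [apply (eval_mono c p); auto; apply E|].
    intros w [N L]. specialize (H (firstn (ht p) w)).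
    assert (Lf : length (firstn (ht p) w) = ht p) by (rewrite length_firstn; lia).
    rewrite nth_firstn in H. destruct (Nat.ltb_spec n (ht p)); [|lia].
    apply H. split; auto. apply Nd; [lia|].
    destruct Wq as (_ & W & _). apply (W _ (skipn (ht p) w)). rewrite firstn_skipn. auto.
  - right. intros v r Wr Er. apply H; auto. eapply ext_trans; eauto.
Qed.

(** The only widening of the top within a stage; it accounts for the bounds [2 ^ k] along the
    chain. *)
Lemma split_tops k c p : k + k <= c -> good k c p ->
  exists q, good (k + k) c q /\ ext p q /\ ht p < ht q /\
    forall w b, top p w -> top q (w ++ [b]).
Proof.
  intros Kc (W & l & Hl & Tl & Lk).
  set (l' := map (fun w => w ++ [true]) l ++ map (fun w => w ++ [false]) l).
  assert (H : forall w, In w l' -> exists v b, w = v ++ [b] /\ top p v).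
  { intros w Hw. apply in_app_or in Hw as [Hw|Hw]; apply in_map_iff in Hw as (v & <- & I);
      apply Tl in I; eauto. }
  assert (T : forall w b, top p w -> top (add_level p l') (w ++ [b])).
  { intros w b Hw. split.
    - right. apply in_or_app. apply Tl in Hw.
      destruct b; [left|right]; apply in_map_iff; eauto.
    - destruct Hw as [_ L]. cbn. rewrite length_app. cbn. lia. }
  exists (add_level p l'). split; [|split; [split|split]]; auto.
  - apply add_level_good; auto.
    + unfold l'. destruct l; cbn; [auto|discriminate].
    + unfold l'. rewrite length_app, !length_map. lia.
  - eapply add_level_endext; eauto.
  - intros w Hw. exists [false]. auto.
Qed.

(* Split every top node at position [n].  If, with both halves kept alive, some
   pair commits to a value of bit [n], kill that half and start again with the
   remaining pairs; the splitting that nobody commits to is kept for good. *)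
Lemma diagonalize k c (L : list (sig * list nat)) p : k + k <= c -> good k c p ->
  exists r, good (k + k) c r /\ ext p r /\ forall f e, In (f, e) L -> beats c r f e.
Proof.
  intros Kc. remember (length L) as m eqn:Hm. revert L p Hm.
  induction m as [m IH] using lt_wf_ind. intros L p Hm G.
  destruct (split_tops k c p Kc G) as (p' & G' & E' & Hh & T').
  set (n := ht p) in *.
  destruct (classic (exists f e v q, In (f, e) L /\ wf c q /\ ext p' q /\
                       eval q f (pr n (bit v) :: e)))
    as [(f & e & v & q & I & Wq & Eq & Hq)|N].
  (* Keeping only strings whose bit [n] differs from [v] returns the top width to [k], so the next
     round can split again from [r]. *)
  - destruct (prune k c p q (fun w => nth n w false <> v))
      as (r & Gr & Er & Eqr & Hhr & Tr); auto.
    + eapply endext_trans; [apply E'|apply Eq].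
    + lia.
    (* Since [q] extends [p'], the half of each top node with bit [negb v] is still alive in [q]. *)
    + intros w Tw. destruct (proj2 Eq _ (T' w (negb v) Tw)) as [u Hu].
      exists (negb v :: u). rewrite <- app_assoc in Hu. split; [|exact Hu].
      destruct Tw as [_ Lw]. rewrite app_nth2 by lia. rewrite Lw.
      replace (n - ht p) with 0 by (subst n; lia). cbn. destruct v; discriminate.
    + assert (Hnq : n < ht q) by (destruct Eq as [[? _] _]; lia).
      assert (B : beats c r f e).
      { exists n. split; [lia|]. left. exists v. split; [apply (eval_mono c q); auto|].
        intros w Tw. destruct (Tr w Tw) as (v' & S' & [_ L'] & ->).
        rewrite app_nth1 by lia. exact S'. }
      apply in_split in I as (L1 & L2 & ->).
      destruct (IH (length (L1 ++ L2))) with (L := L1 ++ L2) (p := r) as (s & Gs & Es & Hs); auto.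
      { subst m. rewrite !length_app. cbn. lia. }
      exists s. split; [auto|split; [eapply ext_trans; eauto|]].
      intros f' e' I. apply in_app_or in I as [I|[[= <- <-]|I]].
      * apply Hs, in_or_app. auto.
      * eapply beats_ext; [apply Gr|apply Gs|auto|auto].
      * apply Hs, in_or_app. auto.
  - exists p'. split; [auto|split; [auto|]]. intros f e I. exists n. split; [auto|].
    right. intros v q Wq Eq Hq. apply N. exists f, e, v, q. auto.
Qed.

(** * Numbering of formulas and the chain of stages *)

Fixpoint enc_list {A} (f : A -> nat) (l : list A) : nat :=
  match l with
  | [] => 0
  | x :: l => S (pr (f x) (enc_list f l))
  end.

Lemma enc_list_inj {A} (f : A -> nat) : (forall x y, f x = f y -> x = y) ->
  forall l m, enc_list f l = enc_list f m -> l = m.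
Proof.
  intros Hf. induction l; intros [|b m] H; cbn in H; try discriminate; auto.
  injection H as H. apply pr_inj in H as [H1 H2]. f_equal; auto.
Qed.

Fixpoint enc_term (t : term) : nat :=
  match t with
  | Var n => pr 0 n
  | Zero => pr 1 0
  | One => pr 2 0
  | Plus s t => pr 3 (pr (enc_term s) (enc_term t))
  | Times s t => pr 4 (pr (enc_term s) (enc_term t))
  end.

Fixpoint enc_sig (f : sig) : nat :=
  match f with
  | SEq s t => pr 0 (pr (enc_term s) (enc_term t))
  | SLt s t => pr 1 (pr (enc_term s) (enc_term t))
  | SIn t => pr 2 (enc_term t)
  | SOut t => pr 3 (enc_term t)
  | SAnd f g => pr 4 (pr (enc_sig f) (enc_sig g))
  | SOr f g => pr 5 (pr (enc_sig f) (enc_sig g))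
  | SAll t f => pr 6 (pr (enc_term t) (enc_sig f))
  | SEx f => pr 7 (enc_sig f)
  | SSub l f => pr 8 (pr (enc_list enc_term l) (enc_sig f))
  end.

Lemma enc_term_inj : forall s t, enc_term s = enc_term t -> s = t.
Proof.
  induction s; intros [] H; cbn [enc_term] in H; apply pr_inj in H as [H0 H];
    try discriminate; auto;
    apply pr_inj in H as [? ?]; f_equal; auto.
Qed.

Lemma enc_sig_inj : forall f g, enc_sig f = enc_sig g -> f = g.
Proof.
  pose proof enc_term_inj as T. pose proof (enc_list_inj _ enc_term_inj) as TL.
  induction f; intros [] H; cbn [enc_sig] in H; apply pr_inj in H as [H0 H];
    try discriminate; try (apply pr_inj in H as [? ?]); f_equal; auto.
Qed.

(** The Goedel number of a formula with its parameters. A stage starting from [p] treats the pairs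
    numbered below [ht p], which are finitely many by injectivity. *)
Definition enc (f : sig) (e : list nat) : nat := pr (enc_sig f) (enc_list (fun n => n) e).

Lemma finite_below {A} (f : A -> nat) : (forall x y, f x = f y -> x = y) ->
  forall n, exists l, forall x, f x < n -> In x l.
Proof.
  intros Hf. induction n as [|n [l Hl]].
  - exists []. intros; lia.
  - destruct (classic (exists x, f x = n)) as [[x Hx]|N].
    + exists (x :: l). intros y Hy. destruct (Nat.eq_dec (f y) n).
      * left. apply Hf. congruence.
      * right. apply Hl. lia.
    + exists l. intros y Hy. apply Hl. assert (f y <> n) by eauto. lia.
Qed.

(** The growth clause will close the cut under arithmetic and coding; decision yields collection and
    induction; [beats] rules out paths. *)
Definition stage (c : nat) (g : nat -> nat) (p q : cond) : Prop :=
  ext p q /\ g (ht p) <= ht q /\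
  forall f e, enc f e < ht p ->
    (forall s, wf c s -> ext q s -> eval s f e -> eval q f e) /\ beats c q f e.

(** Of the three steps only [diagonalize] widens the top, and what it achieves survives the other
    two by [beats_ext]. *)
Lemma stage_exists k c g p : k + k <= c -> good k c p ->
  exists q, good (k + k) c q /\ stage c g p q.
Proof.
  intros Kc G.
  destruct (finite_below (fun x : sig * list nat => enc (fst x) (snd x))) with (n := ht p)
    as [L HL].
  { intros [f e] [f' e'] H. apply pr_inj in H as [H1 H2].
    apply enc_sig_inj in H1. apply enc_list_inj in H2; auto. cbn in *. congruence. }
  destruct (diagonalize k c L p Kc G) as (p1 & G1 & E1 & H1).
  destruct (grow (k + k) c p1 (g (ht p)) Kc G1) as (p2 & G2 & E2 & H2).
  destruct (decide (k + k) c p2 L Kc G2) as (p3 & G3 & E3 & H3).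
  exists p3. split; [auto|split; [|split]].
  - eapply ext_trans; [|eauto]. eapply ext_trans; eauto.
  - destruct E3 as [[? _] _]. lia.
  - intros f e H. specialize (HL (f, e) H). split; [exact (H3 f e HL)|].
    assert (E13 : ext p1 p3) by (eapply ext_trans; eauto).
    apply (beats_ext c p1); [apply G1|apply G3|auto|auto].
Qed.

Lemma good_start c n : 1 <= c ->
  good 1 c {| ht := n; node w := length w <= n /\ w = repeat false (length w) |}.
Proof.
  intros Hc. split; [split; [|split]|].
  - cbn. tauto.
  - cbn. intros u v [L E]. rewrite length_app in *. split; [lia|].
    (* A prefix of a constant string is constant: both sides are truncated to the length of [u]. *)
    rewrite repeat_app in E.
    assert (X : firstn (length u) (u ++ v) =
        firstn (length u) (repeat false (length u) ++ repeat false (length v))) by congruence.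
    rewrite firstn_app, firstn_all, Nat.sub_diag in X. cbn in X. rewrite app_nil_r in X.
    rewrite X at 1. rewrite firstn_app, repeat_length, Nat.sub_diag.
    rewrite firstn_all2 by (rewrite repeat_length; auto). cbn. apply app_nil_r.
  - cbn. intros m l ND H.
    assert (length l <= length [repeat false m]); [|cbn in *; lia].
    apply NoDup_incl_length; auto. intros w Hw. destruct (H w Hw) as [[_ E] <-]. left. auto.
  - exists [repeat false n]. split; [discriminate|split; [|auto]].
    intros w. unfold top. cbn. split.
    + intros [<-|[]]. rewrite repeat_length. auto.
    + intros [[_ E] <-]. auto.
Qed.

(** Each of the [i] stages doubles the top, so the width bound [2 ^ i] is never exceeded. Starting
    at height at least [2 ^ i] puts this bound into the cut. *)
Theorem stages (g : nat -> nat) i : exists f : nat -> cond,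
  2 ^ i <= ht (f 0) /\
  (forall k, k <= i -> good (2 ^ k) (2 ^ i) (f k)) /\
  (forall k, k < i -> stage (2 ^ i) g (f k) (f (S k))).
Proof.
  assert (N : forall kp : nat * cond, exists q, fst kp < i -> good (2 ^ fst kp) (2 ^ i) (snd kp) ->
             good (2 ^ S (fst kp)) (2 ^ i) q /\ stage (2 ^ i) g (snd kp) q).
  { intros [k p]. cbn [fst snd].
    (* The choice function has to be total; where a guard fails, [p] itself is returned. *)
    destruct (classic (k < i /\ good (2 ^ k) (2 ^ i) p)) as [[L G]|F]; [|exists p; tauto].
    destruct (stage_exists (2 ^ k) (2 ^ i) g p) as (q & Gq & Sq); auto.
    - pose proof (Nat.pow_le_mono_r 2 (S k) i). cbn in H. lia.
    - exists q. intros _ _. split; auto. cbn. rewrite Nat.add_0_r. auto. }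
  apply choice in N as [F HF].
  assert (Pos : 1 <= 2 ^ i) by (pose proof (Nat.pow_le_mono_r 2 0 i); cbn in H; lia).
  set (f := fix f k := match k with
    | 0 => {| ht := 2 ^ i; node w := length w <= 2 ^ i /\ w = repeat false (length w) |}
    | S k => F (k, f k) end).
  assert (G : forall k, k <= i -> good (2 ^ k) (2 ^ i) (f k)).
  { induction k; intros L.
    - apply good_start. auto.
    - apply (HF (k, f k)); cbn [fst snd]; [lia|]. apply IHk. lia. }
  exists f. split; [cbn; auto|split; [auto|]].
  intros k L. apply (HF (k, f k)); cbn [fst snd]; auto. apply G. lia.
Qed.

Section Model.

Context (U : (nat -> Prop) -> Prop)
  (U_mono : forall A B : nat -> Prop, (forall i, A i -> B i) -> U A -> U B)
  (U_and : forall A B : nat -> Prop, U A -> U B -> U (fun i => A i /\ B i))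
  (U_em : forall A : nat -> Prop, U A \/ U (fun i => ~ A i))
  (U_ex : forall A : nat -> Prop, U A -> exists i, A i)
  (U_ge : forall k, U (fun i => k <= i)).

Context (cb : nat -> nat)
  (cb_bound : forall n x, setcode x -> (forall a, inset a x -> a < n) -> x <= cb n)
  (cb_mono : forall n m, n <= m -> cb n <= cb m).

(** Exceeds sums and products of numbers below [n], the constants 0 and 1, [n] itself and [cb n], so
    each operation on the cut costs at most one stage. *)
Definition growth (n : nat) : nat := n * n + n + 2 + cb n.

Context (p : nat -> nat -> cond)
  (p_start : forall i, 2 ^ i <= ht (p i 0))
  (p_good : forall i k, k <= i -> good (2 ^ k) (2 ^ i) (p i k))
  (p_stage : forall i k, k < i -> stage (2 ^ i) growth (p i k) (p i (S k))).

(** * Ultrafilters and propositional connectives *)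

Lemma U_and_iff (A B : nat -> Prop) : U (fun i => A i /\ B i) <-> U A /\ U B.
Proof.
  split; [|intros []; auto]. intros H. split; eapply U_mono; try exact H; cbn; tauto.
Qed.

Lemma U_all (A : nat -> Prop) : (forall i, A i) -> U A.
Proof. intros H. eapply U_mono; [|apply (U_ge 0)]. auto. Qed.

Lemma U_and2 (A B C : nat -> Prop) :
  U A -> U B -> (forall i, A i -> B i -> C i) -> U C.
Proof.
  intros HA HB H. eapply U_mono; [|apply (U_and _ _ HA HB)]. cbn. intros i []; auto.
Qed.

Lemma U_not (A : nat -> Prop) : U (fun i => ~ A i) <-> ~ U A.
Proof.
  split.
  - intros H1 H2. destruct (U_ex _ (U_and _ _ H1 H2)) as [i []]; auto.
  - intros H. destruct (U_em A); tauto.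
Qed.

Lemma U_imp (A B : nat -> Prop) : U (fun i => A i -> B i) <-> (U A -> U B).
Proof.
  split.
  - intros H HA. eapply U_and2; [exact H|exact HA|]. auto.
  - intros H. destruct (U_em A) as [HA|HA].
    + eapply U_mono; [|apply H, HA]. auto.
    + eapply U_mono; [|exact HA]. cbn. tauto.
Qed.

Lemma U_or (A B : nat -> Prop) : U (fun i => A i \/ B i) <-> U A \/ U B.
Proof.
  split.
  - intros H. destruct (U_em A) as [HA|HA]; [auto|right].
    eapply U_and2; [exact H|exact HA|]. cbn. tauto.
  - intros [H|H]; eapply U_mono; try exact H; cbn; tauto.
Qed.

Lemma U_iff (A B : nat -> Prop) : (forall i, A i <-> B i) -> U A <-> U B.
Proof. intros H. split; apply U_mono; intros i; apply H. Qed.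

Lemma U_equiv (A B : nat -> Prop) : U (fun i => A i <-> B i) <-> (U A <-> U B).
Proof. unfold iff. rewrite U_and_iff, !U_imp. tauto. Qed.

Lemma p_wf i k : k <= i -> wf (2 ^ i) (p i k).
Proof. intros H. apply (p_good i k H). Qed.

Lemma p_ext i k l : k <= l -> l <= i -> ext (p i k) (p i l).
Proof.
  intros H. induction H as [|l H IH]; intros L; [apply ext_refl|].
  eapply ext_trans; [apply IH; lia|]. apply p_stage. lia.
Qed.

Lemma p_ht i k l : k <= l -> l <= i -> ht (p i k) <= ht (p i l).
Proof. intros H L. apply (p_ext i k l H L). Qed.

Lemma p_growth i k : k < i -> growth (ht (p i k)) <= ht (p i (S k)).
Proof. intros H. apply (p_stage i k H). Qed.

(** * The cut of the ultrapower *)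

(** [p i k] is constrained only for [k <= i]; the finitely many indices [i < k] are discarded by
    [U_ge]. *)
Definition below (x : nat -> nat) (k : nat) : Prop := U (fun i => x i < ht (p i k)).

(** Representatives rather than classes, with [d_eq] as equality. As [k] is standard, this is a
    proper cut: the function sending [i] to [ht (p i i)] lies beyond it. *)
Definition D : Type := {x : nat -> nat | exists k, below x k}.

Definition val (x : D) : nat -> nat := proj1_sig x.

Lemma below_le x k l : k <= l -> below x k -> below x l.
Proof.
  intros L H. eapply U_and2; [exact H|exact (U_ge l)|]. cbn. intros i Hi Li.
  pose proof (p_ht i k l L Li). lia.
Qed.

Lemma below_succ (x : nat -> nat) k :
  U (fun i => x i < growth (ht (p i k))) -> below x (S k).
Proof.
  intros H. eapply U_and2; [exact H|exact (U_ge (S k))|]. cbn. intros i Hi Li.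
  pose proof (p_growth i k Li). lia.
Qed.

Lemma below_common (x y : D) : exists k, below (val x) k /\ below (val y) k.
Proof.
  destruct x as [x [k Hk]], y as [y [l Hl]]. exists (max k l). cbn.
  split; [apply (below_le _ k)|apply (below_le _ l)]; auto; lia.
Qed.

Lemma D_le (y : nat -> nat) (x : D) : U (fun i => y i <= val x i) ->
  exists z : D, val z = y.
Proof.
  intros H. assert (E : exists k, below y k).
  { destruct x as [x [k Hk]]. exists k. eapply U_and2; [exact H|exact Hk|]. cbn. lia. }
  exists (exist _ y E). reflexivity.
Qed.

Lemma zro_below : exists k, below (fun _ => 0) k.
Proof. exists 1. apply below_succ, U_all. unfold growth. lia. Qed.

Lemma one_below : exists k, below (fun _ => 1) k.
Proof. exists 1. apply below_succ, U_all. unfold growth. lia. Qed.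

Lemma add_below (x y : D) : exists k, below (fun i => val x i + val y i) k.
Proof.
  destruct (below_common x y) as (k & Hx & Hy). exists (S k). apply below_succ.
  eapply U_and2; [exact Hx|exact Hy|]. cbn. unfold growth. intros. nia.
Qed.

Lemma mul_below (x y : D) : exists k, below (fun i => val x i * val y i) k.
Proof.
  destruct (below_common x y) as (k & Hx & Hy). exists (S k). apply below_succ.
  eapply U_and2; [exact Hx|exact Hy|]. cbn. unfold growth. intros. nia.
Qed.

Lemma ht_below k : exists l, below (fun i => ht (p i k)) l.
Proof. exists (S k). apply below_succ, U_all. unfold growth. nia. Qed.

Lemma pow_below : exists k, below (fun i => 2 ^ i) k.
Proof.
  exists 1. apply below_succ, U_all. intros i. pose proof (p_start i). unfold growth. lia.
Qed.

Lemma cb_below (x : D) : exists k, below (fun i => cb (val x i)) k.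
Proof.
  destruct (below_common x x) as (k & Hx & _). exists (S k). apply below_succ.
  eapply U_mono; [|exact Hx]. cbn. intros i H.
  pose proof (cb_mono (val x i) (ht (p i k))). unfold growth. lia.
Qed.

Definition d_zro : D := exist _ _ zro_below.
Definition d_one : D := exist _ _ one_below.
Definition d_add (x y : D) : D := exist _ _ (add_below x y).
Definition d_mul (x y : D) : D := exist _ _ (mul_below x y).
Definition d_pr (x y : D) : D := d_add (d_mul (d_add x y) (d_add x y)) x.
Definition d_ht (k : nat) : D := exist _ _ (ht_below k).
Definition d_pow : D := exist _ _ pow_below.
Definition d_cb (x : D) : D := exist _ _ (cb_below x).

Lemma D_nat n : exists z : D, forall i, val z i = n.
Proof.
  induction n as [|n [z Hz]].
  - exists d_zro. reflexivity.
  - exists (d_add z d_one). intros i. cbn. rewrite Hz. lia.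
Qed.

(** * Los's theorem for quantifiers over the cut *)

(** A witness chosen coordinatewise may fall outside the cut. The bound [b] prevents this, as the
    cut is closed downwards. *)
Lemma los_ex (Q : nat -> nat -> Prop) (b : D) :
  U (fun i => (exists y, Q i y) -> exists y, y <= val b i /\ Q i y) ->
  (exists y : D, U (fun i => Q i (val y i))) <-> U (fun i => exists y, Q i y).
Proof.
  intros B. split.
  - intros [y H]. eapply U_mono; [|exact H]. cbn. eauto.
  - intros H.
    assert (C : forall i, exists y, ((exists y, Q i y) -> exists y, y <= val b i /\ Q i y) ->
                  (exists y, Q i y) -> y <= val b i /\ Q i y).
    { intros i. destruct (classic (exists y, y <= val b i /\ Q i y)) as [[y Hy]|N].
      - exists y. auto.
      - exists 0. tauto. }
    apply choice in C as [f Hf].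
    assert (Hf' : U (fun i => f i <= val b i /\ Q i (f i))).
    { eapply U_and2; [exact B|exact H|]. auto. }
    apply U_and_iff in Hf' as [H1 H2].
    destruct (D_le f b H1) as [z <-]. eauto.
Qed.

Lemma los_all (Q : nat -> nat -> Prop) (b : D) :
  U (fun i => (forall y, y <= val b i -> Q i y) -> forall y, Q i y) ->
  (forall y : D, U (fun i => Q i (val y i))) <-> U (fun i => forall y, Q i y).
Proof.
  intros B. split.
  - intros H. apply NNPP. rewrite <- U_not. intros N.
    assert (E : exists y : D, U (fun i => ~ Q i (val y i))).
    { apply (los_ex (fun i y => ~ Q i y) b).
      - eapply U_mono; [|exact B]. cbn. intros i Hi [y Hy].
        apply NNPP. intros N'. apply Hy, Hi. intros z Hz. apply NNPP. eauto.
      - eapply U_mono; [|exact N]. cbn. intros i Hi. apply not_all_ex_not, Hi. }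
    destruct E as [y Hy]. apply U_not in Hy. auto.
  - intros H y. eapply U_mono; [|exact H]. auto.
Qed.

(** * Truth of codes and the sets of the model *)

Definition vals (l : list D) (i : nat) : list nat := map (fun x => val x i) l.

(** Truth in the union of the conditions: being made true at some standard stage. *)
Definition Tr (f : sig) (l : list D) : Prop :=
  exists k, U (fun i => eval (p i k) f (vals l i)).

Lemma eval_le f (e : nat -> list nat) k l : k <= l ->
  U (fun i => eval (p i k) f (e i)) -> U (fun i => eval (p i l) f (e i)).
Proof.
  intros L H. eapply U_and2; [exact H|exact (U_ge l)|]. cbn. intros i Hi Li.
  apply (eval_mono (2 ^ i) (p i k)); auto; [apply p_wf; lia|]. apply p_ext; auto.
Qed.

Lemma enc_list_D (l : list D) :
  exists z : D, forall i, val z i = enc_list (fun n => n) (vals l i).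
Proof.
  induction l as [|x l [z Hz]].
  - exists d_zro. reflexivity.
  - exists (d_add (d_pr x z) d_one). intros i.
    change (pr (val x i) (val z i) + 1 =
            S (pr (val x i) (enc_list (fun n => n) (vals l i)))).
    rewrite Hz. lia.
Qed.

(** The formula is standard and its parameters lie in the cut, which is closed under pairing; so
    some standard stage treats the pair. *)
Lemma enc_below f (l : list D) : exists k, below (fun i => enc f (vals l i)) k.
Proof.
  destruct (enc_list_D l) as [z Hz]. destruct (D_nat (enc_sig f)) as [w Hw].
  destruct (proj2_sig (d_pr w z)) as [k Hk]. exists k. eapply U_mono; [|exact Hk].
  cbn. intros i H. unfold val in Hz, Hw. rewrite Hz, Hw in H. exact H.
Qed.

Lemma stage_eval i k l f e : k < i -> l <= i -> enc f e < ht (p i k) ->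
  eval (p i l) f e -> eval (p i (S k)) f e.
Proof.
  intros Hk Hl He H. destruct (Nat.le_gt_cases l (S k)).
  - apply (eval_mono (2 ^ i) (p i l)); auto; [apply p_wf; lia|]. apply p_ext; auto.
  - destruct (p_stage i k Hk) as (_ & _ & S). apply (S f e He) with (s := p i l); auto.
    + apply p_wf. auto.
    + apply p_ext; lia.
Qed.

(** The stage after [k] has already made true whatever a later one makes true. The search through
    all standard stages becomes a single one, and a Sigma_1 class becomes internal on arguments
    whose codes lie below stage [k]. *)
Lemma Tr_stage f (l : list D) k : below (fun i => enc f (vals l i)) k ->
  Tr f l <-> U (fun i => eval (p i (S k)) f (vals l i)).
Proof.
  intros B. split; [|intros H; exists (S k); exact H].
  intros [m H]. eapply U_and2; [|exact (U_ge (S k + m))|].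
  - exact (U_and _ _ H B).
  - cbn. intros i [H1 H2] L. apply (stage_eval i k m); auto; lia.
Qed.

Lemma Tr_vals f (l l' : list D) : U (fun i => vals l i = vals l' i) -> Tr f l -> Tr f l'.
Proof.
  intros E [k H]. exists k. eapply U_and2; [exact E|exact H|]. cbn. intros i <-. auto.
Qed.

Lemma Tr_and f g l : Tr (SAnd f g) l <-> Tr f l /\ Tr g l.
Proof.
  unfold Tr. cbn [eval]. split.
  - intros [k H]. apply U_and_iff in H as []. eauto.
  - intros [[k Hk] [m Hm]]. exists (max k m). apply U_and_iff.
    split; [apply (eval_le f _ k)|apply (eval_le g _ m)]; auto; lia.
Qed.

Lemma Tr_or f g l : Tr (SOr f g) l <-> Tr f l \/ Tr g l.
Proof.
  unfold Tr. cbn [eval]. split.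
  - intros [k H]. apply U_or in H as [H|H]; eauto.
  - intros [[k H]|[k H]]; exists k; apply U_or; auto.
Qed.

Lemma Tr_ex f l : Tr (SEx f) l <-> exists y : D, Tr f (y :: l).
Proof.
  unfold Tr. cbn [eval]. split.
  - intros [k H].
    apply (los_ex (fun i y => y < ht (p i k) /\ eval (p i k) f (y :: vals l i)) (d_ht k)) in H
      as [y H].
    + exists y, k. eapply U_mono; [|exact H]. cbn. tauto.
    + apply U_all. intros i (y & Ly & Hy). exists y. cbn. split; [lia|auto].
  (* [SEx] wants a witness below the height, so the stage must also be late enough to bound [y]. *)
  - intros (y & k & H). destruct (proj2_sig y) as [m Hm].
    exists (max k m). apply (eval_le f _ k (max k m)) in H; [|lia].
    apply (below_le _ m (max k m)) in Hm; [|lia].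
    eapply U_and2; [exact H|exact Hm|]. cbn. intros i H1 H2. exists (val y i). auto.
Qed.

Fixpoint d_teval (l : list D) (t : term) : D :=
  match t with
  | Var n => nth n l d_zro
  | Zero => d_zro
  | One => d_one
  | Plus s t => d_add (d_teval l s) (d_teval l t)
  | Times s t => d_mul (d_teval l s) (d_teval l t)
  end.

Lemma val_d_teval l t i : val (d_teval l t) i = teval (vals l i) t.
Proof.
  induction t; cbn; auto.
  (* The default of [nth] is 0 on one side and [d_zro] on the other; writing 0 as the value of
     [d_zro] lets [map_nth] apply. *)
  unfold vals. change 0 with ((fun x => val x i) d_zro) at 1. rewrite map_nth. reflexivity.
Qed.

Lemma Tr_sub ts f l : Tr (SSub ts f) l <-> Tr f (map (d_teval l) ts).
Proof.
  unfold Tr. cbn [eval].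
  assert (E : forall i, map (teval (vals l i)) ts = vals (map (d_teval l) ts) i).
  { intros i. unfold vals at 2. rewrite map_map. apply map_ext. intros t.
    symmetry. apply val_d_teval. }
  split; intros [k H]; exists k; (eapply U_mono; [|exact H]); cbn; intros i; rewrite E; auto.
Qed.

Lemma Tr_eq s t l :
  Tr (SEq s t) l <-> U (fun i => val (d_teval l s) i = val (d_teval l t) i).
Proof.
  unfold Tr. cbn [eval]. split.
  - intros [_ H]. eapply U_mono; [|exact H]. cbn. intros i. rewrite !val_d_teval. auto.
  - intros H. exists 0. eapply U_mono; [|exact H]. cbn. intros i. rewrite !val_d_teval. auto.
Qed.

Lemma Tr_lt s t l :
  Tr (SLt s t) l <-> U (fun i => val (d_teval l s) i < val (d_teval l t) i).
Proof.
  unfold Tr. cbn [eval]. split.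
  - intros [_ H]. eapply U_mono; [|exact H]. cbn. intros i. rewrite !val_d_teval. auto.
  - intros H. exists 0. eapply U_mono; [|exact H]. cbn. intros i. rewrite !val_d_teval. auto.
Qed.

(** Monotonicity in the first parameter lets a stage that treats a bound treat all smaller arguments
    uniformly. *)
Lemma enc_head_le f y z e : y <= z -> enc f (y :: e) <= enc f (z :: e).
Proof.
  intros H. apply pr_le; auto. cbn. apply le_n_S, pr_le; auto.
Qed.

(* Collection: by the stage property a single level decides all instances below the bound. *)
Lemma Tr_all t f l : Tr (SAll t f) l <->
  forall y : D, U (fun i => val y i < val (d_teval l t) i) -> Tr f (y :: l).
Proof.
  split.
  - intros [k H] y Hy. exists k. eapply U_and2; [exact H|exact Hy|]. cbn.
    intros i H1 H2. apply H1. rewrite <- val_d_teval. auto.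
  - intros H. destruct (enc_below f (d_teval l t :: l)) as [k Hk]. exists (S k).
    cbn [eval].
    apply (los_all (fun i y => y < teval (vals l i) t -> eval (p i (S k)) f (y :: vals l i))
             (d_teval l t)).
    + apply U_all. intros i Hi y Ly. apply Hi; auto. rewrite val_d_teval. lia.
    + intros y. apply U_imp. intros Hy.
      assert (Hy' : U (fun i => val y i < val (d_teval l t) i)).
      { eapply U_mono; [|exact Hy]. cbn. intros i. rewrite val_d_teval. auto. }
      apply (Tr_stage f (y :: l) k); [|apply H; auto].
      eapply U_and2; [exact Hk|exact Hy'|]. cbn [vals map]. intros i H1 H2.
      eapply Nat.le_lt_trans; [|exact H1]. apply enc_head_le. lia.
Qed.

(** * Delta_1 classes and the structure *)

Definition delta (X : D -> Prop) (f g : sig) (l : list D) : Prop :=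
  forall x, (X x <-> Tr f (x :: l)) /\ (~ X x <-> Tr g (x :: l)).

Definition Sets : Type := {X : D -> Prop | exists f g l, delta X f g l}.

Definition d_eq (x y : D) : Prop := U (fun i => val x i = val y i).

Definition d_lt (x y : D) : Prop := U (fun i => val x i < val y i).

Definition In_set (x : D) (X : Sets) : Prop := proj1_sig X x.

Lemma In_set_equ x y X : d_eq x y -> In_set x X -> In_set y X.
Proof.
  destruct X as [X (f & g & l & H)]. cbn. intros E Hx.
  apply (proj1 (H x)) in Hx. apply (proj1 (H y)). eapply Tr_vals; [|exact Hx].
  eapply U_mono; [|exact E]. cbn. intros i ->. auto.
Qed.

Definition model : structure.
Proof.
  refine {| dom := D; zro := d_zro; one := d_one; add := d_add; mul := d_mul;
            equ := d_eq; lss := d_lt; sets := Sets; mem := In_set |}.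
  - intros x. apply U_all. auto.
  - intros x y. apply U_mono. auto.
  - intros x y z H1 H2. eapply U_and2; [exact H1|exact H2|]. cbn. congruence.
  - intros x y z w H1 H2. eapply U_and2; [exact H1|exact H2|]. cbn. congruence.
  - intros x y z w H1 H2. eapply U_and2; [exact H1|exact H2|]. cbn. congruence.
  - intros x y z w H1 H2 H3. eapply U_and2; [exact (U_and _ _ H1 H2)|exact H3|].
    cbn. intros i [-> ->]. auto.
  - apply In_set_equ.
Defined.

(** * The axioms of RCA_0 hold *)

Fixpoint tbound (t : term) : nat :=
  match t with
  | Var n => S n
  | Zero | One => 0
  | Plus s t | Times s t => max (tbound s) (tbound t)
  end.

(** Environments of [sat] are infinite, whereas [sig] reads a list; this keeps the first [n]
    variables. *)
Definition first {A} (e : nat -> A) (n : nat) : list A := map e (seq 0 n).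

Lemma first_cons {A} (x : A) e n : first (cons_env x e) (S n) = x :: first e n.
Proof. unfold first. cbn. f_equal. rewrite <- seq_shift, map_map. reflexivity. Qed.

Lemma tval_first (e : nat -> D) n l t : tbound t <= n ->
  d_teval (first e n ++ l) t = tval model e t.
Proof.
  induction t; cbn; intros H; auto.
  - rewrite app_nth1 by (unfold first; rewrite length_map, length_seq; lia).
    unfold first. rewrite (nth_indep _ d_zro (e 0)) by (rewrite length_map, length_seq; lia).
    rewrite map_nth, seq_nth by lia. reflexivity.
  - rewrite IHt1, IHt2 by lia. reflexivity.
  - rewrite IHt1, IHt2 by lia. reflexivity.
Qed.

Lemma d_teval_segment (l m r : list D) :
  map (d_teval (l ++ m ++ r)) (map Var (seq (length l) (length m))) = m.
Proof.
  rewrite map_map. cbn [d_teval]. revert l. induction m as [|x m IH]; intros l; cbn; auto.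
  f_equal.
  - rewrite app_nth2, Nat.sub_diag by lia. reflexivity.
  - specialize (IH (l ++ [x])). rewrite length_app, <- app_assoc in IH. cbn in IH.
    rewrite Nat.add_1_r in IH. exact IH.
Qed.

(** The parameter lists are concatenated; [SSub] with a list of variables then selects the segment
    each definition was written for. *)
Lemma common_parameters (r : nat -> Sets) n :
  exists l, forall X, X < n -> exists f g, delta (proj1_sig (r X)) f g l.
Proof.
  induction n as [|n [l IH]].
  - exists []. intros; lia.
  - destruct (proj2_sig (r n)) as (f & g & m & H).
    exists (l ++ m). intros X L. destruct (Nat.eq_dec X n) as [->|N].
    + set (ts := Var 0 :: map Var (seq (S (length l)) (length m))).
      exists (SSub ts f), (SSub ts g). intros x. rewrite !Tr_sub.
      replace (map (d_teval (x :: l ++ m)) ts) with (x :: m); [apply H|].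
      subst ts. cbn [map]. f_equal.
      pose proof (d_teval_segment (x :: l) m []) as E. rewrite app_nil_r in E.
      symmetry. exact E.
    + destruct (IH X) as (f' & g' & H'); [lia|].
      set (ts := Var 0 :: map Var (seq 1 (length l))).
      exists (SSub ts f'), (SSub ts g'). intros x. rewrite !Tr_sub.
      replace (map (d_teval (x :: l ++ m)) ts) with (x :: l); [apply H'|].
      subst ts. cbn [map]. f_equal. symmetry. exact (d_teval_segment [x] l m).
Qed.

Lemma tval_shift (x : D) e t : tval model (cons_env x e) (tshift t) = tval model e t.
Proof. unfold tshift. rewrite tval_tsubst. reflexivity. Qed.

Lemma tbound_shift t : tbound (tshift t) <= S (tbound t).
Proof. induction t; cbn in *; lia. Qed.

Lemma Tr_lt_shift x e n l t : tbound t <= n ->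
  Tr (SLt (Var 0) (tshift t)) (x :: first e n ++ l) <-> d_lt x (tval model e t).
Proof.
  intros L. rewrite Tr_lt. cbn [d_teval nth].
  change (x :: first e n ++ l) with ((x :: first e n) ++ l).
  pose proof (tbound_shift t).
  rewrite <- first_cons, tval_first, tval_shift by lia. reflexivity.
Qed.

(** As [sig] has no negation, the induction carries one formula for truth and one for falsity;
    bounded quantifiers rest on [Tr_all]. The pair is uniform in the number environment, and the set
    parameters [l] sit behind its first [n] values. *)
Lemma bounded_delta q (r : nat -> Sets) : bounded q -> exists n0, forall n l, n0 <= n ->
  (forall X, X < n0 -> exists f g, delta (proj1_sig (r X)) f g l) ->
  exists f g, forall e : nat -> D,
    (sat model e r q <-> Tr f (first e n ++ l)) /\
    (~ sat model e r q <-> Tr g (first e n ++ l)).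
Proof.
  induction 1 as [|s t|s t|t X|a b _ [na IHa] _ [nb IHb]|a b _ [na IHa] _ [nb IHb]
                 |a b _ [na IHa] _ [nb IHb]|t a _ [na IHa]|t a _ [na IHa]].
  - exists 0. intros n l _ _. exists (SLt Zero Zero), (SEq Zero Zero). intros e.
    rewrite Tr_lt, Tr_eq. cbn. split; split.
    + tauto.
    + intros H. apply U_ex in H as [? ?]. lia.
    + intros _. apply U_all. auto.
    + tauto.
  - exists (max (tbound s) (tbound t)). intros n l L _.
    exists (SEq s t), (SOr (SLt s t) (SLt t s)). intros e.
    rewrite Tr_or, !Tr_lt, Tr_eq, !tval_first by lia. cbn. unfold d_eq.
    split; [reflexivity|]. rewrite <- U_not, <- U_or. apply U_iff. intros i. lia.
  - exists (max (tbound s) (tbound t)). intros n l L _.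
    exists (SLt s t), (SOr (SEq s t) (SLt t s)). intros e.
    rewrite Tr_or, !Tr_lt, Tr_eq, !tval_first by lia. cbn. unfold d_lt.
    split; [reflexivity|]. rewrite <- U_not, <- U_or. apply U_iff. intros i. lia.
  - exists (S (max (tbound t) X)). intros n l L H.
    destruct (H X) as (f & g & Hfg); [lia|].
    set (ts := t :: map Var (seq n (length l))).
    exists (SSub ts f), (SSub ts g). intros e. rewrite !Tr_sub.
    replace (map (d_teval (first e n ++ l)) ts) with (tval model e t :: l); [apply Hfg|].
    subst ts. cbn [map]. f_equal; [symmetry; apply tval_first; lia|].
    pose proof (d_teval_segment (first e n) l []) as E.
    rewrite app_nil_r in E. unfold first at 2 in E.
    rewrite length_map, length_seq in E. symmetry. exact E.
  - exists (max na nb). intros n l L H.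
    destruct (IHa n l) as (f & g & Hf); [lia|intros; apply H; lia|].
    destruct (IHb n l) as (f' & g' & Hf'); [lia|intros; apply H; lia|].
    exists (SOr g f'), (SAnd f g'). intros e. specialize (Hf e). specialize (Hf' e).
    rewrite Tr_or, Tr_and. cbn [sat]. tauto.
  - exists (max na nb). intros n l L H.
    destruct (IHa n l) as (f & g & Hf); [lia|intros; apply H; lia|].
    destruct (IHb n l) as (f' & g' & Hf'); [lia|intros; apply H; lia|].
    exists (SAnd f f'), (SOr g g'). intros e. specialize (Hf e). specialize (Hf' e).
    rewrite Tr_or, Tr_and. cbn [sat]. tauto.
  - exists (max na nb). intros n l L H.
    destruct (IHa n l) as (f & g & Hf); [lia|intros; apply H; lia|].
    destruct (IHb n l) as (f' & g' & Hf'); [lia|intros; apply H; lia|].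
    exists (SOr f f'), (SAnd g g'). intros e. specialize (Hf e). specialize (Hf' e).
    rewrite Tr_or, Tr_and. cbn [sat]. tauto.
  - exists (max na (tbound t)). intros n l L H.
    (* The bound variable takes position 0 and moves the parameters up by one place. *)
    destruct (IHa (S n) l) as (f & g & Hf); [lia|intros; apply H; lia|].
    exists (SAll t f), (SEx (SAnd (SLt (Var 0) (tshift t)) g)). intros e.
    assert (Hfx : forall x, (sat model (cons_env x e) r a <-> Tr f (x :: first e n ++ l)) /\
                      (~ sat model (cons_env x e) r a <-> Tr g (x :: first e n ++ l))).
    { intros x. specialize (Hf (cons_env x e)). rewrite first_cons in Hf. exact Hf. }
    assert (HL : forall x, tval model (cons_env x e) (tshift t) = tval model e t)
      by (intros; apply tval_shift).
    rewrite Tr_all, Tr_ex, tval_first by lia.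
    setoid_rewrite Tr_and. setoid_rewrite Tr_lt_shift; [|lia].
    cbn [sat tval cons_env]. setoid_rewrite HL.
    split; split.
    + intros Hs x Hx. apply (proj1 (Hfx x)), Hs, Hx.
    + intros Hs x Hx. apply (proj1 (Hfx x)), Hs, Hx.
    + intros N. apply not_all_ex_not in N as [x N]. apply imply_to_and in N as [Hx N].
      exists x. split; [exact Hx|]. apply (proj2 (Hfx x)), N.
    + intros (x & Hx & Hg) Hs. apply (proj2 (Hfx x)) in Hg. apply Hg, Hs, Hx.
  - exists (max na (tbound t)). intros n l L H.
    destruct (IHa (S n) l) as (f & g & Hf); [lia|intros; apply H; lia|].
    exists (SEx (SAnd (SLt (Var 0) (tshift t)) f)), (SAll t g). intros e.
    assert (Hfx : forall x, (sat model (cons_env x e) r a <-> Tr f (x :: first e n ++ l)) /\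
                      (~ sat model (cons_env x e) r a <-> Tr g (x :: first e n ++ l))).
    { intros x. specialize (Hf (cons_env x e)). rewrite first_cons in Hf. exact Hf. }
    assert (HL : forall x, tval model (cons_env x e) (tshift t) = tval model e t)
      by (intros; apply tval_shift).
    rewrite Tr_all, Tr_ex, tval_first by lia.
    setoid_rewrite Tr_and. setoid_rewrite Tr_lt_shift; [|lia].
    cbn [sat tval cons_env]. setoid_rewrite HL.
    split; split.
    + intros (x & Hx & Hs). exists x. split; [exact Hx|]. apply (proj1 (Hfx x)), Hs.
    + intros (x & Hx & Hs). exists x. split; [exact Hx|]. apply (proj1 (Hfx x)), Hs.
    + intros N x Hx. apply (proj2 (Hfx x)). intros Hs.
      apply N. exists x. split; [exact Hx|exact Hs].
    + intros Hs (x & Hx & Ha). exact (proj2 (proj2 (Hfx x)) (Hs x Hx) Ha).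
Qed.

(** Up to [b] the class [P] agrees with the internal predicate [Q], read off at one stage. If [b]
    were outside [P], each coordinate would have a least failure, and the predecessors would form an
    element of the cut at which the induction step breaks. *)
Lemma model_induction q e r : bounded q ->
  let P := fun x => sat model (cons_env x e) r (ExNum q) in
  P d_zro -> (forall x, P x -> P (d_add x d_one)) -> forall x, P x.
Proof.
  intros B P P0 PS b.
  destruct (bounded_delta q r B) as [n H].
  destruct (common_parameters r n) as [l Hl].
  destruct (H (S (S n)) l) as (f & g & Hf); [lia|auto|].
  set (m := first e n ++ l).
  assert (HP : forall x, P x <-> Tr (SEx f) (x :: m)).
  { intros x. rewrite Tr_ex. unfold P. cbn [sat].
    split; intros [y Hy]; exists y; specialize (Hf (cons_env y (cons_env x e)));
      rewrite !first_cons in Hf; apply Hf, Hy. }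
  destruct (enc_below (SEx f) (b :: m)) as [k Hk].
  assert (HS : forall x, U (fun i => val x i <= val b i) ->
            (P x <-> U (fun i => eval (p i (S k)) (SEx f) (val x i :: vals m i)))).
  { intros x Hx. rewrite HP. apply (Tr_stage _ (x :: m) k).
    eapply U_and2; [exact Hk|exact Hx|]. cbn [vals map]. intros i H1 H2.
    eapply Nat.le_lt_trans; [|exact H1]. apply enc_head_le. auto. }
  set (Q := fun i x => eval (p i (S k)) (SEx f) (x :: vals m i)) in *.
  apply NNPP. intros Nb.
  assert (E : exists y : D, U (fun i => val y i < val b i /\ Q i (val y i) /\ ~ Q i (S (val y i)))).
  { apply (los_ex (fun i y => y < val b i /\ Q i y /\ ~ Q i (S y)) b).
    - apply U_all. intros i (y & L & Hy). exists y. split; [lia|auto].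
    - apply HS in P0; [|apply U_all; intros; cbn; lia].
      rewrite HS in Nb by (apply U_all; auto). apply U_not in Nb.
      eapply U_and2; [exact P0|exact Nb|]. cbn [d_zro val proj1_sig]. intros i H0 Hb.
      fold (Q i 0) in H0. fold (Q i (val b i)) in Hb.
      (* The least failure is not 0, so it is a successor [S y], and [Q] still holds at [y]. *)
      destruct (least_nat (fun x => ~ Q i x) (val b i) Hb) as ([|y] & L & N & M); [tauto|].
      exists y. split; [lia|split; [|exact N]]. apply NNPP. apply (M y). lia. }
  destruct E as [y Hy]. apply U_and_iff in Hy as [L Hy]. apply U_and_iff in Hy as [Hy N].
  assert (PSy : P (d_add y d_one)).
  { apply PS, HS; auto. eapply U_mono; [|exact L]. cbn. lia. }
  apply HS in PSy.
  - apply U_not in N. apply N. eapply U_mono; [|exact PSy]. cbn [d_add val proj1_sig d_one].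
    intros i. rewrite Nat.add_1_r. auto.
  - eapply U_mono; [|exact L]. cbn. intros; lia.
Qed.

(** The falsity formula of [q'], existentially quantified, defines the complement; with the truth
    formula of [q] this makes the class Delta_1. *)
Lemma model_comprehension q q' e r : bounded q -> bounded q' ->
  (forall x, sat model (cons_env x e) r (ExNum q) <-> sat model (cons_env x e) r (AllNum q')) ->
  exists X : Sets, forall x, In_set x X <-> sat model (cons_env x e) r (ExNum q).
Proof.
  intros B B' E.
  destruct (bounded_delta q r B) as [n H]. destruct (bounded_delta q' r B') as [n' H'].
  destruct (common_parameters r (max n n')) as [l Hl].
  destruct (H (S (S (max n n'))) l) as (f & g' & Hf); [lia|intros; apply Hl; lia|].
  destruct (H' (S (S (max n n'))) l) as (f' & g & Hg); [lia|intros; apply Hl; lia|].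
  set (m := first e (max n n') ++ l).
  assert (F : exists f g l, delta (fun x => sat model (cons_env x e) r (ExNum q)) f g l).
  { exists (SEx f), (SEx g), m. intros x. rewrite !Tr_ex. split.
    - cbn [sat]. split; intros [y Hy]; exists y; specialize (Hf (cons_env y (cons_env x e)));
        rewrite !first_cons in Hf; apply Hf, Hy.
    - rewrite E. cbn [sat]. split.
      + intros N. apply not_all_ex_not in N as [y Hy]. exists y.
        specialize (Hg (cons_env y (cons_env x e))). rewrite !first_cons in Hg. apply Hg, Hy.
      + intros [y Hy] A. specialize (Hg (cons_env y (cons_env x e))).
        rewrite !first_cons in Hg. apply Hg in Hy; auto. }
  exists (exist (fun X : D -> Prop => exists f g l, delta X f g l) _ F). intros x. reflexivity.
Qed.

Lemma model_basic q e r : In q basic_axioms -> sat model e r q.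
Proof.
  intros H. cbn in H. repeat destruct H as [<-|H]; try destruct H; cbn; unfold d_eq, d_lt, val; cbn.
  - intros x H. apply U_ex in H as [i H]. lia.
  - intros x y. apply U_mono. intros i. unfold val. lia.
  - intros x. apply U_all. intros i. unfold val. lia.
  - intros x y. apply U_all. intros i. unfold val. lia.
  - intros x. apply U_all. intros i. unfold val. lia.
  - intros x y. apply U_all. intros i. unfold val. nia.
  - intros x H. apply U_ex in H as [i H]. lia.
  - intros x y. rewrite <- U_or. split; apply U_mono; intros i; unfold val; lia.
Qed.

Theorem model_RCA0 q : RCA0 q -> forall e r, sat model e r q.
Proof.
  intros [a Ha|a [b [Hb ->]]|a c [b [Hb ->]] [d [Hd ->]]] e r.
  - apply model_basic, Ha.
  - cbn [sat]. intros [H0 HS] x. revert x. apply (model_induction b e r Hb).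
    + apply sat_instN in H0. exact H0.
    + intros x Hx. specialize (HS x Hx). unfold succ_inst in HS. apply sat_subst in HS.
      eapply sat_equ; [| |exact HS]; [|reflexivity].
      intros [|n]; cbn; apply U_all; auto.
  - intros H. cbn [sat] in H.
    destruct (model_comprehension b d e r Hb Hd) as [X HX].
    + intros x. cbn [sat]. specialize (H x). cbn [sat Iff] in H. tauto.
    + exists X. intros x. specialize (HX x).
      assert (HX' : In_set x X <-> sat model (cons_env x e) (cons_env X r) (shiftS (ExNum b))).
      { rewrite sat_shiftS. exact HX. }
      exact (conj (proj1 HX') (proj2 HX')).
Qed.

(** * Coding in the model *)

Lemma los_ex_bounded (Q : nat -> nat -> Prop) (b : D) :
  (forall i y, Q i y -> y <= val b i) ->
  (exists y : D, U (fun i => Q i (val y i))) <-> U (fun i => exists y, Q i y).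
Proof.
  intros H. apply (los_ex Q b), U_all. intros i [y Hy]. eauto.
Qed.

Lemma los_all_bounded (Q : nat -> nat -> Prop) (b : D) :
  (forall i y, ~ Q i y -> y <= val b i) ->
  (forall y : D, U (fun i => Q i (val y i))) <-> U (fun i => forall y, Q i y).
Proof.
  intros H. apply (los_all Q b), U_all. intros i Hi y. apply NNPP. intros N.
  apply N, Hi. auto.
Qed.

(** The predicates with prefix [m_] are what the corresponding formulas unfold to in [model]; the
    lemmas named [los_] evaluate the coding ones coordinatewise. *)
Definition m_dvd (a b : D) : Prop := exists q, d_eq b (d_mul a q).

Definition m_inset (a x : D) : Prop :=
  exists k m n, d_eq x (d_pr k (d_pr m n)) /\ d_lt a k /\
    m_dvd (d_add (d_mul m (d_add a d_one)) d_one) n.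

Definition m_setrep (x : D) : Prop := exists k m n, d_eq x (d_pr k (d_pr m n)).

Definition m_setcode (x : D) : Prop :=
  m_setrep x /\
  (forall y, d_lt y x -> m_setrep y -> ~ (forall a, m_inset a x <-> m_inset a y)).

Definition m_len (s l : D) : Prop :=
  forall i, d_lt i l <-> exists j, m_inset (d_pr i j) s.

Definition m_seq (s : D) : Prop :=
  m_setcode s /\
  (forall x, m_inset x s -> exists i j, d_eq x (d_pr i j)) /\
  (forall i j k, m_inset (d_pr i j) s -> m_inset (d_pr i k) s -> d_eq j k) /\
  (exists l, m_len s l).

Definition m_bin (s : D) : Prop :=
  m_seq s /\ (forall i j, m_inset (d_pr i j) s -> d_eq j d_zro \/ d_eq j d_one).

Definition m_sub (s t : D) : Prop := forall x, m_inset x s -> m_inset x t.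

Definition m_card (x k : D) : Prop :=
  exists s, m_seq s /\ m_len s k /\
    (forall i j a, m_inset (d_pr i a) s -> m_inset (d_pr j a) s -> d_eq i j) /\
    (forall a, m_inset a x <-> exists i, m_inset (d_pr i a) s).

Definition m_card_le (A : D -> Prop) (c : D) : Prop :=
  forall x, m_setcode x -> (forall a, m_inset a x -> A a) ->
  exists k, m_card x k /\ (d_lt k c \/ d_eq k c).

Definition m_tree (T : Sets) : Prop :=
  (forall s, In_set s T -> m_bin s) /\
  (forall s t, In_set t T -> m_bin s -> m_sub s t -> In_set s T).

Definition m_infinite (T : Sets) : Prop := ~ exists k, forall s, In_set s T -> d_lt s k.

Definition m_ext_level (T : Sets) (n s : D) : Prop :=
  In_set s T /\ m_len s n /\
  forall m, exists t, In_set t T /\ m_sub s t /\ exists l, m_len t l /\ (d_lt m l \/ d_eq m l).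

Definition m_path (T f : Sets) : Prop :=
  ((forall x, In_set x f -> exists i j, d_eq x (d_pr i j)) /\
   (forall i, exists j, In_set (d_pr i j) f /\ forall k, In_set (d_pr i k) f -> d_eq k j)) /\
  (forall n, exists s, (m_seq s /\ m_len s n /\
     forall i j, m_inset (d_pr i j) s -> In_set (d_pr i j) f) /\ In_set s T).

Lemma sat_WKL_ext_bd e r : sat model e r WKL_ext_bd <->
  forall T, m_tree T -> m_infinite T ->
    (exists c, forall n, m_card_le (m_ext_level T n) c) -> exists f, m_path T f.
Proof. reflexivity. Qed.

Lemma los_dvd a b : m_dvd a b <-> U (fun i => dvd (val a i) (val b i)).
Proof.
  apply (los_ex (fun i q => val b i = val a i * q) b).
  apply U_all. intros i [q Hq]. destruct (val a i) as [|m].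
  (* For divisor 0 the given quotient may exceed the bound, but the dividend is 0 and the quotient 0
     serves. *)
  - exists 0. lia.
  - exists q. nia.
Qed.

(** Components of a pair are bounded by the pair, so all three quantifiers range up to [x] and pass
    through the ultrafilter one at a time, the innermost first. *)
Lemma los_inset a x : m_inset a x <-> U (fun i => inset (val a i) (val x i)).
Proof.
  set (R := fun i k m n => val x i = pr k (pr m n) /\ val a i < k /\
                           dvd (m * (val a i + 1) + 1) n).
  assert (B : forall i k m n, R i k m n -> k <= val x i /\ m <= val x i /\ n <= val x i).
  { intros i k m n [-> _]. pose proof (pr_fst k (pr m n)). pose proof (pr_snd k (pr m n)).
    pose proof (pr_fst m n). pose proof (pr_snd m n). lia. }
  transitivity (exists k m n : D, U (fun i => R i (val k i) (val m i) (val n i))).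
  { unfold m_inset. setoid_rewrite los_dvd. unfold R. setoid_rewrite U_and_iff.
    setoid_rewrite U_and_iff. reflexivity. }
  transitivity (exists k m : D, U (fun i => exists n, R i (val k i) (val m i) n)).
  { split; intros (k & m & H); exists k, m;
      (apply (los_ex_bounded (fun i n => R i (val k i) (val m i) n) x); [|exact H]);
      intros i n Hn; apply B in Hn; tauto. }
  transitivity (exists k : D, U (fun i => exists m n, R i (val k i) m n)).
  { split; intros (k & H); exists k;
      (apply (los_ex_bounded (fun i m => exists n, R i (val k i) m n) x); [|exact H]);
      intros i n [m Hn]; apply B in Hn; tauto. }
  apply (los_ex_bounded (fun i k => exists m n, R i k m n) x).
  intros i k (m & n & Hn). apply B in Hn. tauto.
Qed.

Lemma los_setrep x : m_setrep x <-> U (fun i => setrep (val x i)).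
Proof.
  assert (B : forall k m n, k <= pr k (pr m n) /\ m <= pr k (pr m n) /\ n <= pr k (pr m n)).
  { intros k m n. pose proof (pr_fst k (pr m n)). pose proof (pr_snd k (pr m n)).
    pose proof (pr_fst m n). pose proof (pr_snd m n). lia. }
  transitivity (exists k m : D, U (fun i => exists n, val x i = pr (val k i) (pr (val m i) n))).
  { split; intros (k & m & H); exists k, m;
      (apply (los_ex_bounded (fun i n => val x i = pr (val k i) (pr (val m i) n)) x); [|exact H]);
      intros i n ->; apply B. }
  transitivity (exists k : D, U (fun i => exists m n, val x i = pr (val k i) (pr m n))).
  { split; intros (k & H); exists k;
      (apply (los_ex_bounded (fun i m => exists n, val x i = pr (val k i) (pr m n)) x); [|exact H]);
      intros i m [n ->]; apply B. }
  apply (los_ex_bounded (fun i k => exists m n, val x i = pr k (pr m n)) x).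
  intros i k (m & n & ->). apply B.
Qed.

Lemma los_same_members x y : (forall a, m_inset a x <-> m_inset a y) <->
  U (fun i => forall a, inset a (val x i) <-> inset a (val y i)).
Proof.
  setoid_rewrite los_inset. setoid_rewrite <- U_equiv.
  apply (los_all_bounded (fun i a => inset a (val x i) <-> inset a (val y i)) (d_add x y)).
  cbn. intros i a N. destruct (Nat.le_gt_cases a (val x i + val y i)); auto.
  exfalso. apply N. split; intros H1; apply inset_lt in H1; lia.
Qed.

Lemma los_setcode x : m_setcode x <-> U (fun i => setcode (val x i)).
Proof.
  unfold m_setcode, setcode. rewrite U_and_iff, los_setrep.
  setoid_rewrite los_setrep. setoid_rewrite los_same_members.
  setoid_rewrite <- U_not. unfold d_lt. setoid_rewrite <- U_imp. setoid_rewrite <- U_imp.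
  rewrite (los_all_bounded (fun i y => y < val x i -> setrep y ->
             ~ (forall a, inset a (val x i) <-> inset a y)) x); [reflexivity|].
  intros i y N. destruct (Nat.le_gt_cases y (val x i)); auto. exfalso. apply N. lia.
Qed.

Lemma los_dom (i0 s : D) : (exists j, m_inset (d_pr i0 j) s) <->
  U (fun i => exists j, inset (pr (val i0 i) j) (val s i)).
Proof.
  setoid_rewrite los_inset.
  apply (los_ex_bounded (fun i j => inset (pr (val i0 i) j) (val s i)) s).
  intros i j H. apply inset_lt in H. pose proof (pr_snd (val i0 i) j). lia.
Qed.

Lemma los_len s l : m_len s l <-> U (fun i => haslen (val s i) (val l i)).
Proof.
  unfold m_len, haslen. setoid_rewrite los_dom. unfold d_lt. setoid_rewrite <- U_equiv.
  apply (los_all_bounded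
    (fun i j => j < val l i <-> exists k, inset (pr j k) (val s i)) (d_add s l)).
  cbn. intros i j N. destruct (Nat.le_gt_cases j (val s i + val l i)); auto.
  exfalso. apply N. split; [lia|]. intros [k Hk]. apply inset_lt in Hk.
  pose proof (pr_fst j k). lia.
Qed.

Lemma haslen_le s l : haslen s l -> l <= s.
Proof.
  intros H. destruct l as [|l]; [lia|]. destruct (proj1 (H l)) as [j Hj]; [lia|].
  apply inset_lt in Hj. pose proof (pr_fst l j). lia.
Qed.

Lemma los_pair x : (exists i j, d_eq x (d_pr i j)) <-> U (fun i => exists j k, val x i = pr j k).
Proof.
  transitivity (exists k : D, U (fun i => exists m, val x i = pr (val k i) m)).
  { split; intros (k & H); exists k;
      (apply (los_ex_bounded (fun i m => val x i = pr (val k i) m) x); [|exact H]);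
      intros i m ->; apply pr_snd. }
  apply (los_ex_bounded (fun i k => exists m, val x i = pr k m) x).
  intros i k (m & ->). apply pr_fst.
Qed.

Lemma los_all_members (Q : nat -> nat -> Prop) (A : D -> Prop) x :
  (forall a, A a <-> U (fun i => Q i (val a i))) ->
  (forall a, m_inset a x -> A a) <-> U (fun i => forall a, inset a (val x i) -> Q i a).
Proof.
  intros H. setoid_rewrite los_inset. setoid_rewrite H. setoid_rewrite <- U_imp.
  apply (los_all_bounded (fun i a => inset a (val x i) -> Q i a) x).
  intros i a N. apply imply_to_and in N as [N _]. apply inset_lt in N. lia.
Qed.

Lemma los_functional s :
  (forall i j k, m_inset (d_pr i j) s -> m_inset (d_pr i k) s -> d_eq j k) <->
  U (fun n => forall i j k, inset (pr i j) (val s n) -> inset (pr i k) (val s n) -> j = k).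
Proof.
  set (R := fun n i j k => inset (pr i j) (val s n) -> inset (pr i k) (val s n) -> j = k).
  assert (B : forall n i j k, ~ R n i j k -> i <= val s n /\ j <= val s n /\ k <= val s n).
  { intros n i j k N. apply imply_to_and in N as [H1 N]. apply imply_to_and in N as [H2 _].
    apply inset_lt in H1, H2. pose proof (pr_fst i j). pose proof (pr_snd i j).
    pose proof (pr_snd i k). lia. }
  setoid_rewrite los_inset. unfold d_eq. setoid_rewrite <- U_imp. setoid_rewrite <- U_imp.
  transitivity (forall i j : D, U (fun n => forall k, R n (val i n) (val j n) k)).
  { split; intros H i j; specialize (H i j);
      (apply (los_all_bounded (fun n k => R n (val i n) (val j n) k) s); [|exact H]);
      intros n k N; apply B in N; tauto. }
  transitivity (forall i : D, U (fun n => forall j k, R n (val i n) j k)).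
  { split; intros H i; specialize (H i);
      (apply (los_all_bounded (fun n j => forall k, R n (val i n) j k) s); [|exact H]);
      intros n j N; apply not_all_ex_not in N as [k N]; apply B in N; tauto. }
  apply (los_all_bounded (fun n i => forall j k, R n i j k) s).
  intros n i N. apply not_all_ex_not in N as [j N]. apply not_all_ex_not in N as [k N].
  apply B in N. tauto.
Qed.

Lemma los_seq s : m_seq s <-> U (fun i => seqcode (val s i)).
Proof.
  unfold m_seq, seqcode. rewrite !U_and_iff, los_setcode, los_functional.
  rewrite (los_all_members (fun i x => exists j k, x = pr j k) _ s los_pair).
  setoid_rewrite los_len. rewrite (los_ex_bounded (fun i l => haslen (val s i) l) s);
    [reflexivity|]. intros i l. apply haslen_le.
Qed.

Lemma los_bin s : m_bin s <-> U (fun i => bincode (val s i)).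
Proof.
  unfold m_bin, bincode. rewrite U_and_iff, los_seq.
  set (R := fun n i j => inset (pr i j) (val s n) -> j = 0 \/ j = 1).
  assert (B : forall n i j, ~ R n i j -> i <= val s n /\ j <= val s n).
  { intros n i j N. apply imply_to_and in N as [H1 N].
    apply inset_lt in H1. pose proof (pr_fst i j). pose proof (pr_snd i j). lia. }
  assert (E : (forall i j, m_inset (d_pr i j) s -> d_eq j d_zro \/ d_eq j d_one) <->
              U (fun n => forall i j, R n i j)); [|rewrite E; reflexivity].
  setoid_rewrite los_inset. unfold d_eq. setoid_rewrite <- U_or. setoid_rewrite <- U_imp.
  transitivity (forall i : D, U (fun n => forall j, R n (val i n) j)).
  { split; intros H i; specialize (H i);
      (apply (los_all_bounded (fun n j => R n (val i n) j) s); [|exact H]);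
      intros n j N; apply B in N; tauto. }
  apply (los_all_bounded (fun n i => forall j, R n i j) s).
  intros n i N. apply not_all_ex_not in N as [j N]. apply B in N. tauto.
Qed.

Lemma los_sub s t :
  m_sub s t <-> U (fun i => forall x, inset x (val s i) -> inset x (val t i)).
Proof.
  apply (los_all_members (fun i x => inset x (val t i))). intros a. apply los_inset.
Qed.

(** The members of the code of [w i] lie below a number of the cut, so [cb] bounds the code itself
    within the cut. *)
Lemma strcode_D (w : nat -> list bool) (n : D) : U (fun i => length (w i) <= val n i) ->
  exists s : D, U (fun i => strcode (w i) (val s i)).
Proof.
  intros H.
  assert (E : forall i, exists s, strcode (w i) s) by (intros; apply strcode_exists).
  apply choice in E as [f Hf].
  destruct (D_le f (d_cb (d_add (d_pr n d_one) d_one))) as [s Hs].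
  - eapply U_mono; [|exact H]. intros i Hi.
    apply cb_bound; [apply Hf|]. intros a Ha.
    apply (strcode_entries _ _ _ (Hf i)) in Ha.
    pose proof (pr_le (length (w i)) 1 (val n i) 1 Hi (le_n _)).
    change (a < pr (val n i) 1 + 1). lia.
  - exists s. rewrite Hs. apply U_all. auto.
Qed.

Lemma set_enum x : exists l, NoDup l /\ forall a, In a l <-> inset a x.
Proof.
  assert (H : forall n, exists l, NoDup l /\ forall a, In a l <-> inset a x /\ a < n).
  { induction n as [|n (l & ND & Hl)].
    - exists []. split; [constructor|]. intros a. cbn. lia.
    - destruct (classic (inset n x)) as [Hn|Hn].
      + exists (n :: l). split.
        * constructor; auto. rewrite Hl. lia.
        * intros a. cbn. rewrite Hl. split.
          -- intros [<-|[? ?]]; auto with arith.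
          -- intros [Ha L]. destruct (Nat.eq_dec n a); auto. right. split; auto. lia.
      + exists l. split; auto. intros a. rewrite Hl. split; intros [Ha L]; split; auto.
        assert (a <> n) by congruence. lia. }
  destruct (H x) as (l & ND & Hl). exists l. split; auto. intros a. rewrite Hl.
  split; [tauto|]. intros Ha. split; auto. apply inset_lt, Ha.
Qed.

(** An enumeration is chosen in each coordinate, and [cb] keeps its code in the cut. *)
Lemma m_card_exists (x : D) (l : nat -> list nat) :
  (forall i, NoDup (l i) /\ forall a, In a (l i) <-> inset a (val x i)) ->
  exists k, m_card x k /\ forall i, val k i = length (l i).
Proof.
  intros H.
  assert (Len : forall i, length (l i) <= val x i).
  { intros i. destruct (H i) as [ND Hl]. rewrite <- (length_seq (val x i) 0).
    apply NoDup_incl_length; auto. intros a Ha. apply Hl, inset_lt in Ha.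
    apply in_seq. lia. }
  assert (E : forall i, exists s, seqcode s /\ haslen s (length (l i)) /\
    (forall i j a, inset (pr i a) s -> inset (pr j a) s -> i = j) /\
    (forall a, In a (l i) <-> exists i, inset (pr i a) s) /\
    (forall y, inset y s -> y < S (pr (length (l i)) (val x i)))).
  { intros i. apply enumeration_code; [apply H|]. intros a Ha. apply inset_lt, H, Ha. }
  apply choice in E as [f Hf].
  destruct (D_le (fun i => length (l i)) x) as [k Hk]; [apply U_all, Len|].
  destruct (D_le f (d_cb (d_add (d_pr x x) d_one))) as [s Hs].
  { apply U_all. intros i. destruct (Hf i) as (Sq & _ & _ & _ & B).
    apply cb_bound; [apply Sq|]. intros a Ha. apply B in Ha.
    pose proof (pr_le (length (l i)) (val x i) (val x i) (val x i) (Len i) (le_n _)).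
    change (a < pr (val x i) (val x i) + 1). lia. }
  exists k. split; [|intros i; rewrite Hk; reflexivity].
  exists s. rewrite los_seq, los_len, Hs, Hk. split; [|split; [|split]].
  - apply U_all. intros i. apply Hf.
  - apply U_all. intros i. apply Hf.
  - intros i j a Hi Hj. apply los_inset in Hi, Hj. rewrite Hs in Hi, Hj.
    eapply U_and2; [exact Hi|exact Hj|]. intros n Hn1 Hn2. eapply (Hf n); [exact Hn1|exact Hn2].
  - intros a. rewrite los_inset.
    assert (E : (exists i, m_inset (d_pr i a) s) <->
                U (fun n => exists i, inset (pr i (val a n)) (val s n))).
    { setoid_rewrite los_inset.
      apply (los_ex_bounded (fun n i => inset (pr i (val a n)) (val s n)) s).
      intros n i Hi. apply inset_lt in Hi. pose proof (pr_fst i (val a n)). lia. }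
    rewrite E, Hs. apply U_iff. intros n. destruct (Hf n) as (_ & _ & _ & Hl & _).
    rewrite <- Hl. symmetry. apply H.
Qed.

(** * The tree *)

Lemma node_level i k m w : k <= i -> m <= i -> length w <= ht (p i k) ->
  node (p i m) w -> node (p i k) w.
Proof.
  intros Hk Hm L N. destruct (Nat.le_gt_cases k m).
  - apply (p_ext i k m); auto.
  - destruct (p_ext i m k) as [[_ E] _]; [lia|auto|]. apply E; auto.
    apply (p_wf i m Hm), N.
Qed.

(** If [x] lies below stage [k], that stage has settled every string [x] can code, so non-membership
    shows up as [SOut] there. An exclusion is never revoked, as the conditions agree on strings
    within their heights. *)
Lemma T_delta : delta (fun x => Tr (SIn (Var 0)) [x]) (SIn (Var 0)) (SOut (Var 0)) [].
Proof.
  intros x. split; [reflexivity|]. unfold Tr. cbn [eval teval vals map nth]. split.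
  - intros N. destruct (proj2_sig x) as [k Hk]. exists k.
    destruct (U_em (fun i => exists w, strcode w (val x i) /\ node (p i k) w)) as [Y|Y].
    + exfalso. eauto.
    + eapply U_and2; [exact Hk|exact Y|]. cbn. intros i L NE w Hw. split.
      * apply strcode_length in Hw. change (proj1_sig x i) with (val x i) in L. lia.
      * intros Nw. eauto.
  - intros [k H] [m H'].
    assert (F : U (fun _ => False)); [|apply U_ex in F as [_ []]].
    eapply U_and2; [exact (U_and _ _ H H')|exact (U_ge (k + m))|].
    cbn. intros i [O (w & Hw & Nw)] L. destruct (O w Hw) as [Lw Nk].
    apply Nk. apply (node_level i k m); auto; lia.
Qed.

Definition T : Sets :=
  exist (fun X : D -> Prop => exists f g l, delta X f g l) _
    (ex_intro _ _ (ex_intro _ _ (ex_intro _ _ T_delta))).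

Lemma T_tree : m_tree T.
Proof.
  split.
  - intros s [k H]. apply los_bin. eapply U_mono; [|exact H]. cbn.
    intros i (w & Hw & _). eapply strcode_bincode, Hw.
  - intros s t [k H] Bs St. exists k. apply los_bin in Bs. apply los_sub in St.
    eapply U_and2; [exact (U_and _ _ H Bs)|exact (U_and _ _ St (U_ge k))|].
    cbn. intros i [(w & Hw & Nw) Bi] [Si L].
    apply bincode_strcode in Bi as [v Hv]. exists v. split; auto.
    destruct (strcode_prefix v w _ _ Hv Hw Si) as [u ->].
    apply (p_wf i k L) in Nw. exact Nw.
Qed.

(** If [b] lies below stage [k], a top node of [p i k] has a code at least as large as its length,
    hence above [b]. *)
Lemma T_infinite : m_infinite T.
Proof.
  intros [b H]. destruct (proj2_sig b) as [k Hk].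
  assert (E : forall i, exists w, k <= i -> top (p i k) w).
  { intros i. destruct (classic (k <= i)) as [L|L]; [|exists []; tauto].
    destruct (p_good i k L) as (_ & [|w l] & Hl & Tl & _); [tauto|].
    exists w. intros _. apply Tl. left. auto. }
  apply choice in E as [w Hw].
  destruct (strcode_D w (d_ht k)) as [s Hs].
  { eapply U_mono; [|exact (U_ge k)]. cbn. intros i L. destruct (Hw i L) as [_ ->]. auto. }
  assert (I : In_set s T).
  { exists k. eapply U_and2; [exact Hs|exact (U_ge k)|]. cbn. intros i Hi L.
    exists (w i). split; auto. apply Hw, L. }
  apply H in I. unfold d_lt in I.
  assert (F : U (fun _ => False)); [|apply U_ex in F as [_ []]].
  eapply U_and2; [exact (U_and _ _ I Hs)|exact (U_and _ _ Hk (U_ge k))|].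
  cbn. intros i [L1 Hi] [L2 L]. apply strcode_length in Hi. destruct (Hw i L) as [_ Lw].
  change (proj1_sig b i) with (val b i) in L2. lia.
Qed.

Lemma In_T_level x k : below (val x) k -> In_set x T ->
  U (fun i => exists w, strcode w (val x i) /\ node (p i k) w).
Proof.
  intros B [m H]. eapply U_and2; [exact (U_and _ _ B H)|exact (U_ge (k + m))|].
  cbn. intros i [L (w & Hw & Nw)] Li. exists w. split; auto.
  change (strcode w (val x i)) in Hw. pose proof (strcode_length _ _ Hw).
  apply (node_level i k m); auto; lia.
Qed.

(** All members of [x] lie below one stage [k], where they code distinct nodes of [p i k] of one
    length; the width bound [2 ^ i] of that condition applies. *)
Lemma T_width n : m_card_le (m_ext_level T n) d_pow.
Proof.
  intros x Hx HA. destruct (proj2_sig x) as [k Hk].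
  assert (HU : U (fun i => forall a, inset a (val x i) ->
             exists w, strcode w a /\ node (p i k) w /\ length w = val n i)).
  { apply (los_all_bounded (fun i a => inset a (val x i) ->
             exists w, strcode w a /\ node (p i k) w /\ length w = val n i) x).
    - intros i a N. apply imply_to_and in N as [N _]. apply inset_lt in N. lia.
    - intros a. apply U_imp. intros Ha.
      destruct (HA a) as (It & Ln & _); [apply los_inset, Ha|].
      apply los_len in Ln. apply (In_T_level a k) in It.
      + eapply U_and2; [exact It|exact Ln|]. cbn. intros i (w & Hw & Nw) L.
        exists w. split; [auto|split; auto]. symmetry. apply (strcode_haslen _ _ _ Hw), L.
      + eapply U_and2; [exact Ha|exact Hk|]. cbn. intros i L1 L2. apply inset_lt in L1.
        change (proj1_sig x i) with (val x i) in L2. lia. }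
  assert (E : forall i, exists l, NoDup l /\ forall a, In a l <-> inset a (val x i))
    by (intros; apply set_enum).
  apply choice in E as [l Hl].
  destruct (m_card_exists x l Hl) as (c & Hc & Lc). exists c. split; auto.
  unfold d_lt, d_eq. rewrite <- U_or.
  eapply U_and2; [exact HU|exact (U_ge k)|]. intros i Hi Li. rewrite Lc.
  destruct (Hl i) as [ND Hm].
  assert (E : forall a, exists w, inset a (val x i) ->
             strcode w a /\ node (p i k) w /\ length w = val n i).
  { intros a. destruct (classic (inset a (val x i))) as [Ha|Ha]; [|exists []; tauto].
    destruct (Hi a Ha) as [w Hw]. eauto. }
  apply choice in E as [F HF].
  assert (length (map F (l i)) <= 2 ^ i).
  { apply (p_wf i k Li) with (n := val n i).
    - apply NoDup_map_NoDup_ForallPairs; auto. intros a b Ha Hb E.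
      apply Hm, HF in Ha, Hb. destruct Ha as [Ha _], Hb as [Hb _].
      rewrite E in Ha. eapply strcode_fun; eauto.
    - intros w Hw. apply in_map_iff in Hw as (a & <- & Ha). apply Hm, HF in Ha. tauto. }
  rewrite length_map in H. change (val d_pow i) with (2 ^ i). lia.
Qed.

(** * Absence of paths *)

Lemma bit_D (Q : nat -> bool -> Prop) : U (fun i => exists b, Q i b) ->
  exists v : D, U (fun i => exists b, val v i = bit b /\ Q i b).
Proof.
  intros H. apply (los_ex_bounded (fun i v => exists b, v = bit b /\ Q i b) d_one).
  - intros i v (b & -> & _). destruct b; cbn; auto.
  - eapply U_mono; [|exact H]. cbn. intros i [b Hb]. eauto.
Qed.

(** Let [h] with parameters [e] define a path. The stage after one bounding their code beats [h] at
    a position [n]. The path runs through a top node of that stage, so [h] does commit to the bit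
    [v] of this node; hence it also commits to a bit [v'] that no top node has, and the path is not
    a function. *)
Lemma T_no_path f : ~ m_path T f.
Proof.
  intros [[_ Hf] HP]. destruct f as [X (h & g & e & HX)].
  assert (Pos : forall x, In_set x (exist _ X (ex_intro _ h (ex_intro _ g (ex_intro _ e HX)))) <->
                          Tr h (x :: e)) by (intros x; apply (HX x)).
  setoid_rewrite Pos in Hf. setoid_rewrite Pos in HP. clear Pos HX.
  destruct (enc_below h e) as [k Hk].
  assert (HB : U (fun i => beats (2 ^ i) (p i (S k)) h (vals e i))).
  { eapply U_and2; [exact Hk|exact (U_ge (S k))|]. cbn. intros i L Li.
    destruct (p_stage i k Li) as (_ & _ & S). apply S, L. }
  (* The positions supplied by [beats] lie below the height, so they form an element of the cut. *)
  apply (los_ex (fun i n => n < ht (p i (S k)) /\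
    ((exists v, eval (p i (S k)) h (pr n (bit v) :: vals e i) /\
        forall w, top (p i (S k)) w -> nth n w false <> v) \/
     (forall v q, wf (2 ^ i) q -> ext (p i (S k)) q ->
        ~ eval q h (pr n (bit v) :: vals e i)))) (d_ht (S k))) in HB as [n HB].
  2: { apply U_all. intros i (n & L & Hn). exists n. cbn. split; [lia|auto]. }
  (* The path is restricted to exactly the height of the stage, which yields a top node. *)
  destruct (HP (d_ht (S k))) as (s & (_ & Ls & Hs) & [m It]).
  assert (Ht : U (fun i => exists w, strcode w (val s i) /\ top (p i (S k)) w)).
  { apply los_len in Ls.
    eapply U_and2; [exact (U_and _ _ Ls It)|exact (U_ge (S k + m))|].
    cbn. intros i [L (w & Hw & Nw)] Li. exists w. split; auto.
    change (strcode w (val s i)) in Hw. apply (strcode_haslen _ _ _ Hw) in L.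
    split; auto. apply (node_level i (S k) m); auto; lia. }
  destruct (bit_D (fun i b => exists w, strcode w (val s i) /\ top (p i (S k)) w /\
                    nth (val n i) w false = b)) as [v Hv].
  { eapply U_mono; [|exact Ht]. cbn. intros i (w & Hw & Tw). eauto. }
  assert (Tv : Tr h (d_pr n v :: e)).
  { apply Hs, los_inset. eapply U_and2; [exact Hv|exact HB|]. cbn beta.
    intros i (b & Eb & w & Hw & [_ Lw] & Nb) [L _].
    change (inset (pr (val n i) (val v i)) (val s i)).
    apply (strcode_inset _ _ _ _ Hw). rewrite Eb, Nb. split; [lia|auto]. }
  (* As [h] accepts the pair of [n] and [v] at some stage, the alternative of never committing fails
     on a set in [U]. *)
  assert (HA : U (fun i => exists b, eval (p i (S k)) h (pr (val n i) (bit b) :: vals e i) /\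
        forall w, top (p i (S k)) w -> nth (val n i) w false <> b)).
  { destruct Tv as [m' Tv]. apply (eval_le _ _ m' (m' + S k)) in Tv; [|lia].
    eapply U_and2; [exact (U_and _ _ HB Hv)|exact (U_and _ _ Tv (U_ge (m' + S k)))|].
    cbn beta. intros i [[_ [Y|N]] (b & Eb & _)] [Ev Li]; auto. exfalso.
    apply (N b (p i (m' + S k))).
    - apply p_wf. auto.
    - apply p_ext; [lia|auto].
    - rewrite <- Eb. exact Ev. }
  destruct (bit_D _ HA) as [v' Hv'].
  assert (Tv' : Tr h (d_pr n v' :: e)).
  { exists (S k). eapply U_mono; [|exact Hv']. cbn beta. intros i (b & Eb & Ev & _).
    rewrite <- Eb in Ev. exact Ev. }
  destruct (Hf n) as (j & _ & Hj).
  pose proof (Hj v Tv) as E. pose proof (Hj v' Tv') as E'. unfold d_eq in E, E'.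
  assert (F : U (fun _ => False)); [|apply U_ex in F as [_ []]].
  eapply U_and2; [exact (U_and _ _ E E')|exact (U_and _ _ Hv Hv')|].
  cbn beta. intros i [-> E2] [(b & Eb & w & _ & Tw & Nb) (b' & Eb' & _ & N)].
  apply (N w Tw). rewrite Nb. apply bit_inj. congruence.
Qed.

(** * Failure of the principle in the model, and unprovability *)

Theorem model_not_WKL e r : ~ sat model e r WKL_ext_bd.
Proof.
  rewrite sat_WKL_ext_bd. intros H.
  destruct (H T T_tree T_infinite) as [f Hf]; [exists d_pow; apply T_width|].
  apply (T_no_path f Hf).
Qed.

Theorem model_unprovable : ~ provable RCA0 WKL_ext_bd.
Proof.
  intros H. apply (model_not_WKL (fun _ => d_zro) (fun _ => T)).
  apply (soundness model RCA0 [] WKL_ext_bd H); [|intros q []].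
  intros q Hq e r. apply model_RCA0, Hq.
Qed.

End Model.

Theorem corollary3p4 : ~ provable RCA0 WKL_ext_bd.
Proof.
  destruct nonprincipal_ultrafilter as (U & U_mono & U_and & U_em & U_ex & U_ge).
  destruct setcode_bound as (cb & cb_bound & cb_mono).
  destruct (choice _ (stages (growth cb))) as [p Hp].
  apply (model_unprovable U U_mono U_and U_em U_ex U_ge cb cb_bound cb_mono p); apply Hp.
Qed.
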